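(* Let $k$ be a field of positive characteristic. For each $n\geqslant 3$, there exists an infinite family of pairwise non-isomorphic rings $C$ ($k$-algebras) of dimension $n$ which are counterexamples to the Zariski Cancellation Problem in positive characteristic, i.e., which satisfy $C^{[1]}=k^{[n+1]}$ but $C\neq k^{[n]}$.
   Context: $R^{[n]}$ denotes a polynomial ring in $n$ variables over a ring $R$; for a $k$-algebra $C$, $C=k^{[n]}$ means that $C$ is isomorphic as a $k$-algebra to a polynomial ring in $n$ variables over $k$, and $C^{[1]}=k^{[n+1]}$ means that the polynomial ring in one variable over $C$ is isomorphic as a $k$-algebra to a polynomial ring in $n+1$ variables over $k$. *)

(* Defs.v *)
From HB Require Import structures.
From mathcomp Require Import all_boot all_order all_algebra.
From mathcomp Require Import mpoly.

Set Implicit Arguments.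
Unset Strict Implicit.
Unset Printing Implicit Defensive.

Import GRing.Theory.
Local Open Scope ring_scope.

(* [idealr_closed] includes properness ([1 \notin P]). *)
Definition prime_ideal_pred (A : comNzRingType) (P : {pred A}) : Prop :=
  idealr_closed P /\ prime_idealr_closed P.

Definition strict_subpred (A : Type) (P Q : {pred A}) : Prop :=
  {subset P <= Q} /\ exists2 x, x \in Q & x \notin P.

(* The length of a chain P_0 < ... < P_m is its number m of strict inclusions. *)
Definition has_prime_chain (A : comNzRingType) (m : nat) : Prop :=
  exists P : 'I_m.+1 -> {pred A},
    (forall i, prime_ideal_pred (P i)) /\
    (forall i j : 'I_m.+1, (i < j)%N -> strict_subpred (P i) (P j)).

Definition krull_dim_is (A : comNzRingType) (d : nat) : Prop :=
  has_prime_chain A d /\ forall m, has_prime_chain A m -> (m <= d)%N.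

Definition ring_isomorphic (A B : comNzRingType) : Prop :=
  exists f : {rmorphism A -> B}, bijective f.

Definition alg_isomorphic (k : fieldType) (A B : comAlgType k) : Prop :=
  exists f : {lrmorphism A -> B}, bijective f.

(* C = k^[n] *)
Definition is_polynomial_ring (k : fieldType) (n : nat) (C : comAlgType k) :
    Prop :=
  alg_isomorphic C {mpoly k[n]}.

(* C^[1] = k^[n].  The library makes {poly C} an algebra over C only; its
   k-algebra structure is obtained by restriction of scalars along
   a |-> a%:A : k -> C, which is what the last clause uses. *)
Definition is_stably_polynomial_ring (k : fieldType) (n : nat)
    (C : comAlgType k) : Prop :=
  exists f : {rmorphism {poly C} -> {mpoly k[n]}},
    bijective f /\
    forall (a : k) (q : {poly C}), f (a%:A%:P * q) = a *: f q.

(* Main.v *)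
Require Import Defs.
From HB Require Import structures.
From mathcomp Require Import all_boot all_order all_algebra.
From mathcomp Require Import boolp.
From mathcomp Require Import mpoly.
From mathcomp Require Import ring zify.

Set Implicit Arguments.
Unset Strict Implicit.
Unset Printing Implicit Defensive.

Import Order.Theory GRing.Theory Num.Theory.
Local Open Scope ring_scope.

(** Let p be the characteristic, let x_1, ..., x_m be variables with m = n - 2,
    put x = x_1 ... x_m, and let f = z^(p^2) - t - t^(p^2 + p).  The family is
    C_e = k[x_1, ..., x_m, y, z, t] / (x^(ep) y - f), for e = 1, 2, 3, ...

    The curve f = 0 is a line: it is parametrised by z = S + S^(p^2 + p) and
    t = S^(p^2), and S is recovered as a polynomial g(z, t).  This is an
    embedding of the line in the plane which is not equivalent to a coordinate
    axis, the classical pathology of positive characteristic.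

    Cancellation.  In three-space every embedded line can be straightened, and
    this gives new coordinates for C_e[w]: with S = x^(ep) w + g(z, t), the
    elements z - S - S^(p^2 + p) and t - S^(p^2) are divisible by x^(ep), and
    C_e[w] is the polynomial ring in the x_j, in S and in the two quotients
    u, v.  Turning this round, C_e is realised below as the subalgebra of the
    polynomial ring P in the x_j, S, u, v generated by the x_j, by
    z = x^(ep) u + S + S^(p^2 + p), by t = x^(ep) v + S^(p^2), and by
    y = f(z, t) / x^(ep); this makes it a domain with all the structure in
    sight ([stably_polynomial]).

    Rigidity.  Call an element c of a ring A a deformation invariant if some
    ring morphism phi : A -> A[U], equal to the identity at U = 0 and not the
    constant embedding, fixes c.  The main point, [invariant_nonneg], is that
    the deformation invariants of C_e have no pole along any x_i when written
    in k[x_1^(+-1), ..., z, t].  Suppose h is invariant and has such a pole.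
    Grade C_e by the order in x_i.  Rescaling U suitably and keeping the terms
    of lowest weight of phi yields a nontrivial morphism of the same kind, now
    homogeneous, which fixes the lowest form of h; this form is divisible by
    y, since every homogeneous element of negative degree is, so y is fixed
    too ([invariant_weight]).  With X the image of x^e, the images z, t
    now satisfy y X^p = f(z, t) with y constant in U.  Setting
    s = z^p - t^(p+1), this reads
      t = s^p - y X^p   and   s = (z - t s)^p + y (t X)^p.
    Since y is not a p-th power in the fraction field, no cancellation between
    a p-th power and y times a p-th power is possible, so
    deg t >= p max (deg s, deg X) and deg s >= p (deg t + deg X); all the
    degrees vanish and the morphism is trivial, a contradiction
    ([segre_rigid]).

    Consequences.  In a polynomial ring in at least two variables every variable
    is a deformation invariant.  If C_e were such a ring it would be generated
    by elements without poles, but y = f / x^(ep) has one ([not_polynomial]).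
    For the isomorphism problem, the deformation invariants of C_e include
    k, the x_j, z and t, thus an isomorphism sigma : C_e -> C_e' maps the base ring
    k[x_1, ..., x_m, z, t] to elements without poles, and so does its inverse.
    This forces sigma(x) to have order at most 1 along each x_i, hence sigma(y)
    has a pole of order at most ep.  When e < e' such an element, reduced modulo x_i,
    does not involve v, whereas y in C_e' reduces to -v; thus sigma is
    not surjective ([non_isomorphic]).

    Dimension.  Setting to 0 one after the other the x_j, then S, then v gives
    n + 1 distinct primes of C_e.  A longer chain is impossible because
    C_e[w] is a polynomial ring in n + 1 variables: n + 2 of its elements are
    algebraically dependent, while elements c_i in P_(i+1) but not in P_i are
    independent ([chain_independent], [algebraically_dependent]). *)

(** * Subalgebras generated by finitely many polynomials *)

Section Subst.
Variables (k : fieldType) (N : nat) (A : comAlgType k).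
Implicit Type h : 'I_N -> A.

Definition subst h : {mpoly k[N]} -> A := mmap (in_alg A) h.

HB.instance Definition _ h := GRing.RMorphism.copy (subst h) (mmap (in_alg A) h).

Lemma substC h a : subst h a%:MP = a%:A.
Proof. exact: mmapC. Qed.

Lemma substX h i : subst h 'X_i = h i.
Proof. by rewrite /subst mmapX mmap1U. Qed.

Lemma subst_scalable h : scalable (subst h).
Proof.
by move=> a q; rewrite -mul_mpolyC [LHS]rmorphM /= substC -scalerAl mul1r.
Qed.

HB.instance Definition _ h :=
  GRing.isScalable.Build k {mpoly k[N]} A *:%R (subst h) (@subst_scalable h).

End Subst.

Lemma mpoly_rmorph_ext (k : fieldType) (N : nat) (R : nzRingType)
    (f g : {rmorphism {mpoly k[N]} -> R}) :
  (forall a, f a%:MP = g a%:MP) -> (forall i, f 'X_i = g 'X_i) -> f =1 g.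
Proof.
move=> fgC fgX; elim/mpolyind => [|a m q _ _ IH]; first by rewrite !rmorph0.
rewrite !rmorphD IH -!mul_mpolyC !rmorphM fgC mpolyXE_id !rmorph_prod.
congr (_ * _ + _); apply: eq_bigr => i _.
by rewrite !rmorphXn fgX.
Qed.

Section ImageAlgebra.
Variables (k : fieldType) (N M : nat) (g : 'I_N -> {mpoly k[M]}).

(** Membership is not decidable, so the boolean predicate is obtained by
    classical reflection. *)
Definition im_subst : {pred {mpoly k[M]}} :=
  fun c => `[< exists H, subst g H = c >].

Lemma im_substP c : reflect (exists H, subst g H = c) (c \in im_subst).
Proof. exact: asboolP. Qed.

Lemma im_subst_subring : subring_closed im_subst.
Proof.
split; first by apply/im_substP; exists 1; rewrite rmorph1.
- move=> _ _ /im_substP[P <-] /im_substP[Q <-].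
  by apply/im_substP; exists (P - Q); rewrite rmorphB.
- move=> _ _ /im_substP[P <-] /im_substP[Q <-].
  by apply/im_substP; exists (P * Q); rewrite rmorphM.
Qed.

Lemma im_subst_scale a : {in im_subst, forall c, a *: c \in im_subst}.
Proof.
by move=> _ /im_substP[P <-]; apply/im_substP; exists (a *: P); rewrite linearZ.
Qed.

HB.instance Definition _ :=
  GRing.isSubringClosed.Build {mpoly k[M]} im_subst im_subst_subring.
HB.instance Definition _ :=
  GRing.isScaleClosed.Build k {mpoly k[M]} im_subst im_subst_scale.

Definition im_alg := {c | c \in im_subst}.
HB.instance Definition _ := SubChoice.on im_alg.
HB.instance Definition _ := [SubChoice_isSubComNzRing of im_alg by <:].
HB.instance Definition _ := [SubZmodule_isSubLmodule of im_alg by <:].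
HB.instance Definition _ :=
  [SubNzRing_SubLmodule_isSubLalgebra of im_alg by <:].
HB.instance Definition _ := GRing.Lalgebra_isComAlgebra.Build k im_alg.

Definition im_val : im_alg -> {mpoly k[M]} := val.
HB.instance Definition _ := GRing.RMorphism.copy im_val (val : im_alg -> _).
HB.instance Definition _ := GRing.Linear.copy im_val (val : im_alg -> _).

Lemma im_val_inj : injective im_val.
Proof. exact: val_inj. Qed.

Lemma im_gen_subproof i : g i \in im_subst.
Proof. by apply/im_substP; exists 'X_i; rewrite substX. Qed.

Definition im_gen i : im_alg := exist _ (g i) (im_gen_subproof i).

Lemma im_val_gen i : im_val (im_gen i) = g i.
Proof. by []. Qed.

Lemma im_val_subst H : im_val (subst im_gen H) = subst g H.
Proof.
have ext := @mpoly_rmorph_ext k N _ (im_val \o subst im_gen) (subst g).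
apply: ext => [a|i] /=; last by rewrite !substX.
by rewrite !substC rmorph_alg.
Qed.

Lemma im_subst_surj c : exists H, c = subst im_gen H.
Proof.
case: c => c cP; case/im_substP: (cP) => H defc; exists H.
by apply: val_inj; rewrite -[RHS]/(im_val _) im_val_subst.
Qed.

End ImageAlgebra.

(** * The line z^(p^2) = t + t^(p^2 + p) and its straightening *)

Section FrobeniusIdentities.
Variables (R : comNzRingType) (p : nat).
Hypothesis pcharRp : p \in [pchar R].
Implicit Types x y z t u v s w xi c S W : R.

Local Notation "x ^p" := (x ^+ p) (at level 1, format "x ^p").

Lemma FrobD x y : (x + y)^p = x^p + y^p.
Proof. by rewrite -!(pFrobenius_autE pcharRp) rmorphD. Qed.

Lemma FrobB x y : (x - y)^p = x^p - y^p.
Proof. by rewrite -!(pFrobenius_autE pcharRp) rmorphB. Qed.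

Lemma FrobN x : (- x)^p = - x^p.
Proof. by rewrite -!(pFrobenius_autE pcharRp) rmorphN. Qed.

Definition FrobE := (FrobB, FrobD, FrobN, exprMn).

(** The three polynomials attached to the line are f = [segre], s = [segre_s]
    and g = [segre_g].  On the line s is the p-th power of the parameter and g
    is the parameter itself: s^p = t + f, hence z - s^(p+1) is the parameter
    modulo f. *)
Definition segre z t := z^p^p - t - t^p^p * t^p.
Definition segre_s z t := z^p - t^p * t.
Definition segre_g z t := z - (segre_s z t)^p * segre_s z t.

(** The parameter [xi] stands for x^(ep), and [c] for xi^(p-1), which enters
    only through xi * c = xi^p.  At xi = 0 the first two are the parametrisation
    of the line; [ycoord] is f(z, t) / xi expanded. *)
Definition zcoord xi u S := xi * u + S + S^p^p * S^p.
Definition tcoord xi v S := xi * v + S^p^p.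
Definition ycoord xi c u v S :=
  c^p * c * u^p^p - v - c * v^p * S^p^p^p^p - c^p * c * v^p^p * S^p^p^p
  - xi^p^p * c * v^p^p * v^p.

Lemma segre_coords xi c u v S : xi * c = xi^p ->
  segre (zcoord xi u S) (tcoord xi v S) = xi * ycoord xi c u v S.
Proof.
move=> xic; rewrite /segre /zcoord /tcoord /ycoord !FrobE -!xic !FrobE.
by rewrite -xic; ring.
Qed.

Lemma zcoord_shift xi u S W : zcoord xi (u + W) S = zcoord xi u S + xi * W.
Proof. by rewrite /zcoord; ring. Qed.

Lemma tcoord_shift xi v S W : tcoord xi (v + W) S = tcoord xi v S + xi * W.
Proof. by rewrite /tcoord; ring. Qed.

(** The effect on y of u |-> u + W and of v |-> v + W.  The second one is written
    in terms of t, so that it visibly stays in the surface algebra: this is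
    where the terms in v and S recombine. *)
Definition ushift c y W := y + c^p * c * W^p^p.

Definition vshift xi c t y W :=
  y - W - c * W^p * t^p^p - c^p * c * W^p^p * t^p - xi^p^p * c * W^p^p * W^p.

Lemma ycoord_shift_u xi c u v S W :
  ycoord xi c (u + W) v S = ushift c (ycoord xi c u v S) W.
Proof. by rewrite /ushift /ycoord !FrobE; ring. Qed.

Lemma ycoord_shift_v xi c u v S W : xi * c = xi^p ->
  ycoord xi c u (v + W) S = vshift xi c (tcoord xi v S) (ycoord xi c u v S) W.
Proof.
move=> xic; rewrite /vshift /ycoord /tcoord !FrobE.
have -> : xi^p^p = xi^p * c^p by rewrite -exprMn xic.
by ring.
Qed.

Lemma ycoord0 u v S : (0 < p)%N -> ycoord 0 0 u v S = - v.
Proof.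
move=> p0; rewrite /ycoord !expr0n eqn0Ngt p0 mulr0n.
by rewrite !(mul0r, mulr0) !subr0 sub0r.
Qed.

(** The quotient (S - g(z, t)) / xi.  The inner polynomial is (s - S^p) / xi. *)
Definition wcoord xi c u v S :=
  let s1 := c * u^p - xi^p * v^p * v - c * v^p * S^p^p - v * S^p^p^p in
  S^p^p * s1 + c * s1^p * S^p + xi^p * s1^p * s1 - u.

Lemma segre_wcoord xi c u v S : xi * c = xi^p ->
  S - segre_g (zcoord xi u S) (tcoord xi v S) = xi * wcoord xi c u v S.
Proof.
move=> xic; rewrite /segre_g /wcoord.
set s1 := _ - v * _.
have -> : segre_s (zcoord xi u S) (tcoord xi v S) = S^p + xi * s1.
  by rewrite /segre_s /zcoord /tcoord /s1 !FrobE -!xic; ring.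
by rewrite /zcoord !FrobE -!xic; ring.
Qed.

(** The quotients (t - S^(p^2)) / xi and (z - S - S^(p^2 + p)) / xi for
    S = xi * W + g(z, t), expressed through y instead of f / xi.  The inner
    polynomial kappa is (S^p - s) / xi. *)
Definition vcoord xi c z t y W :=
  c * t^p^p * y^p + c^p * c * y^p^p * t^p + xi^p^p * c * y^p^p * y^p
  - c^p * c * W^p^p - y.

Definition ucoord xi c z t y W :=
  let kappa := c * W^p - t^p * y - c * y^p * t - xi^p * y^p * y in
  let s := segre_s z t in
  s * y - W - t * kappa + vcoord xi c z t y W * (s + xi * kappa).

Section Inverse.
Variables (xi c z t y W : R).
Hypotheses (xic : xi * c = xi^p) (xiy : xi * y = segre z t).
Let S := xi * W + segre_g z t.

Let segre_sp : (segre_s z t)^p = t + xi * y.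
Proof. by rewrite xiy /segre /segre_s !FrobE; ring. Qed.

(** With [zcoord_ucoord], the inverse change of coordinates.  Everything follows
    from s^p = t + xi * y, because all the other powers of s and S that occur are
    Frobenius images of s. *)
Lemma tcoord_vcoord : tcoord xi (vcoord xi c z t y W) S = t.
Proof.
have xicp : xi^p * c^p = xi^p^p by rewrite -exprMn xic.
have z2 : z^p^p = t + xi * y + t^p^p * t^p by rewrite xiy /segre; ring.
rewrite /tcoord /vcoord /S /segre_g.
move: (segre_s z t) segre_sp => s sp.
rewrite sp !FrobE sp !FrobE z2 -!xicp -!xic; ring.
Qed.

Lemma zcoord_ucoord : zcoord xi (ucoord xi c z t y W) S = z.
Proof.
have Sp : S^p = segre_s z t
    + xi * (c * W^p - t^p * y - c * y^p * t - xi^p * y^p * y).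
  have := erefl (segre_s z t); rewrite {2}/segre_s /S /segre_g.
  move: (segre_s z t) segre_sp => s sp sE.
  rewrite !FrobE sp !FrobE.
  have -> : z^p = s + t^p * t by rewrite sE; ring.
  by rewrite -!xic; ring.
have := tcoord_vcoord; rewrite /tcoord /zcoord => /(canRL (addKr _)) ->.
rewrite Sp /ucoord {1}/S /segre_g segre_sp; ring.
Qed.

End Inverse.

End FrobeniusIdentities.

(** * Weights of monomials and homogeneous components *)

Definition mwt (M : nat) (om : 'I_M -> int) (m : 'X_{1..M}) : int :=
  \sum_i om i *+ m i.

(** Sealed, because unification would otherwise compare unrelated polynomials by
    expanding their components. *)
HB.lock Definition wcomp (k : fieldType) (M : nat) (om : 'I_M -> int)
    (d : int) (q : {mpoly k[M]}) : {mpoly k[M]} :=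
  \sum_(m <- msupp q | mwt om m == d) q@_m *: 'X_[m].

Section Weights.
Variables (k : fieldType) (M : nat) (om : 'I_M -> int).
Implicit Types (q : {mpoly k[M]}) (m : 'X_{1..M}) (d : int).

Local Notation mwt := (@mwt M om).
Local Notation wcomp := (@wcomp k M om).

Lemma mwtE m : mwt m = \sum_i om i *+ m i.
Proof. by []. Qed.

Lemma mwt0 : mwt 0%MM = 0.
Proof. by apply: big1 => i _; rewrite mnm0E. Qed.

Lemma mwtD m1 m2 : mwt (m1 + m2)%MM = mwt m1 + mwt m2.
Proof. by rewrite -big_split; apply: eq_bigr => i _; rewrite mnmDE mulrnDr. Qed.

Lemma mwtU i : mwt U_(i)%MM = om i.
Proof.
rewrite /mwt (bigD1 i) //= mnm1E eqxx big1 ?addr0 // => j ji.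
by rewrite mnm1E eq_sym (negbTE ji).
Qed.

Lemma wcompE d q :
  wcomp d q = \sum_(m <- msupp q | mwt m == d) q@_m *: 'X_[m].
Proof. by rewrite wcomp.unlock. Qed.

Lemma mcoeff_wcomp d q m :
  (wcomp d q)@_m = if mwt m == d then q@_m else 0.
Proof.
rewrite wcompE raddf_sum /= -big_filter.
under eq_bigr => m' _ do rewrite mcoeffZ mcoeffX.
have [mS|mS] := boolP (m \in [seq i <- msupp q | mwt i == d]).
  rewrite (bigD1_seq m) ?filter_uniq ?msupp_uniq //= eqxx mulr1.
  rewrite big1 ?addr0 => [|m' /negbTE->]; last by rewrite mulr0.
  by move: mS; rewrite mem_filter => /andP[->].
rewrite big1_seq => [|m' /andP[_ m'S]]; last first.
  by case: eqP m'S mS => [-> ->|_ _ _] //; rewrite mulr0.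
move: mS; rewrite mem_filter; case: (mwt m == d) => //= mS.
by rewrite memN_msupp_eq0.
Qed.

Lemma wcomp_is_additive d : additive (wcomp d).
Proof.
move=> q1 q2; apply/mpolyP => m; rewrite !(mcoeffB, mcoeff_wcomp).
by case: ifP; rewrite ?subr0.
Qed.

HB.instance Definition _ d :=
  GRing.isAdditive.Build {mpoly k[M]} {mpoly k[M]} (wcomp d)
    (wcomp_is_additive d).

Lemma wcompZ d a q : wcomp d (a *: q) = a *: wcomp d q.
Proof.
apply/mpolyP => m; rewrite !(mcoeffZ, mcoeff_wcomp).
by case: ifP; rewrite ?mulr0.
Qed.

Definition wge d q := all (fun m => d <= mwt m)%R (msupp q).
Definition whom d q := all (fun m => mwt m == d) (msupp q).

Lemma wgeP d q : reflect (forall m, m \in msupp q -> (d <= mwt m)%R) (wge d q).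
Proof. exact: allP. Qed.

Lemma whomP d q : reflect (forall m, m \in msupp q -> mwt m = d) (whom d q).
Proof. by apply: (iffP allP) => h m /h/eqP. Qed.

Lemma wgeW d e q : (d <= e)%R -> wge e q -> wge d q.
Proof. by move=> de /wgeP qe; apply/wgeP => m /qe; apply: le_trans. Qed.

Lemma whom_wge d q : whom d q -> wge d q.
Proof. by move=> /whomP qd; apply/wgeP => m /qd ->. Qed.

Lemma whom_wcomp d q : whom d (wcomp d q).
Proof.
by apply/whomP => m; rewrite mcoeff_msupp mcoeff_wcomp; case: ifP => [/eqP|_]; rewrite ?eqxx.
Qed.

Lemma wcomp_id d q : whom d q -> wcomp d q = q.
Proof.
move=> /whomP qd; apply/mpolyP => m; rewrite mcoeff_wcomp; case: ifP => // /eqP ne.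
by rewrite memN_msupp_eq0 //; apply/negP => /qd.
Qed.

Lemma wcomp_gt d e q : (d < e)%R -> wge e q -> wcomp d q = 0.
Proof.
move=> de /wgeP qe; apply/mpolyP => m; rewrite mcoeff_wcomp mcoeff0.
case: eqP => // md; rewrite memN_msupp_eq0 //; apply/negP => /qe.
by rewrite md leNgt de.
Qed.

Lemma wge0 d : wge d 0.
Proof. by rewrite /wge msupp0. Qed.

Lemma wgeD d q1 q2 : wge d q1 -> wge d q2 -> wge d (q1 + q2).
Proof.
move=> /wgeP h1 /wgeP h2; apply/wgeP => m /msuppD_le.
by rewrite mem_cat => /orP[/h1|/h2].
Qed.

Lemma wgeZ d a q : wge d q -> wge d (a *: q).
Proof. by move=> /wgeP h; apply/wgeP => m /msuppZ_le/h. Qed.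

Lemma wge_sum d (I : Type) (r : seq I) (Q : pred I) (F : I -> {mpoly k[M]}) :
  (forall i, Q i -> wge d (F i)) -> wge d (\sum_(i <- r | Q i) F i).
Proof. by move=> h; elim/big_ind: _ => //; [exact: wge0 | exact: wgeD]. Qed.

Lemma wgeM d1 d2 q1 q2 : wge d1 q1 -> wge d2 q2 -> wge (d1 + d2) (q1 * q2).
Proof.
move=> /wgeP h1 /wgeP h2; apply/wgeP => m.
move=> /msuppM_le/allpairsP[[m1 m2] /= [/h1 m1d /h2 m2d ->]].
by rewrite mwtD; apply: lerD.
Qed.

Lemma whomD d q1 q2 : whom d q1 -> whom d q2 -> whom d (q1 + q2).
Proof.
move=> /whomP h1 /whomP h2; apply/whomP => m /msuppD_le.
by rewrite mem_cat => /orP[/h1|/h2].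
Qed.

Lemma whomN d q : whom d (- q) = whom d q.
Proof. by rewrite /whom (perm_all _ (msuppN _)). Qed.

Lemma whomB d q1 q2 : whom d q1 -> whom d q2 -> whom d (q1 - q2).
Proof. by move=> h1 h2; apply: whomD => //; rewrite whomN. Qed.

Lemma whomM d1 d2 q1 q2 : whom d1 q1 -> whom d2 q2 -> whom (d1 + d2) (q1 * q2).
Proof.
move=> /whomP h1 /whomP h2; apply/whomP => m.
move=> /msuppM_le/allpairsP[[m1 m2] /= [/h1 m1d /h2 m2d ->]].
by rewrite mwtD m1d m2d.
Qed.

Lemma whomC a : whom 0%R a%:MP.
Proof.
by rewrite /whom msuppC; case: ifP => //= _; rewrite mwt0 eqxx.
Qed.

Lemma whomXm m : whom (mwt m) 'X_[m].
Proof. by rewrite /whom msuppX /= eqxx. Qed.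

Lemma whomX i : whom (om i) 'X_i.
Proof. by rewrite -mwtU; apply: whomXm. Qed.

Lemma whomXn d q n : whom d q -> whom (d *+ n) (q ^+ n).
Proof.
move=> qd; elim: n => [|n IH]; first exact: whomC.
by rewrite exprS mulrS; apply: whomM.
Qed.

Lemma whom_prod (I : Type) (r : seq I) (d : I -> int) (F : I -> {mpoly k[M]}) :
  (forall i, whom (d i) (F i)) ->
  whom (\sum_(i <- r) d i) (\prod_(i <- r) F i).
Proof.
move=> h; elim/big_ind2: _ => //; first exact: whomC.
by move=> q1 d1 q2 d2; apply: whomM.
Qed.

(** Lowest-weight components multiply: the remainders have weight at least one
    more, since weights are integers. *)
Lemma wcompM d1 d2 q1 q2 : wge d1 q1 -> wge d2 q2 ->
  wcomp (d1 + d2) (q1 * q2) = wcomp d1 q1 * wcomp d2 q2.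
Proof.
have split_q d q : wge d q -> wge (d + 1) (q - wcomp d q).
  move=> /wgeP qd; apply/wgeP => m; rewrite mcoeff_msupp mcoeffB mcoeff_wcomp.
  case: ifP => [_|/eqP md]; first by rewrite subrr eqxx.
  rewrite subr0 -mcoeff_msupp => /qd; lia.
move=> h1 h2; have r1 := split_q _ _ h1; have r2 := split_q _ _ h2.
have c1 := whom_wcomp d1 q1; have c2 := whom_wcomp d2 q2.
rewrite -{1}(subrK (wcomp d1 q1) q1) mulrDl raddfD /= (wcomp_gt _ (wgeM r1 h2)); last lia.
rewrite add0r -{1}(subrK (wcomp d2 q2) q2) mulrDr raddfD /=.
rewrite (wcomp_gt _ (wgeM (whom_wge c1) r2)); last lia.
by rewrite add0r wcomp_id //; apply: whomM.
Qed.

Lemma wlow_exists q : q != 0 -> exists d, wge d q /\ wcomp d q != 0.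
Proof.
rewrite -msupp_eq0; case defS: (msupp q) => [|m0 S] // _.
have [m mS mmin] : exists2 m, m \in msupp q &
      forall m', m' \in msupp q -> (mwt m <= mwt m')%R.
  rewrite defS {defS}; elim: S m0 => [|m1 S IH] m0.
    by exists m0; rewrite ?mem_head // => m; rewrite inE => /eqP ->.
  have [m mS mmin] := IH m1.
  have [le|lt] := leP (mwt m0) (mwt m).
    exists m0; rewrite ?mem_head // => m'; rewrite inE => /orP[/eqP -> //|/mmin].
    exact: le_trans.
  exists m; first by rewrite inE mS orbT.
  by move=> m'; rewrite inE => /orP[/eqP -> //|/mmin //]; apply: ltW.
exists (mwt m); split; first exact/wgeP.
rewrite -msupp_eq0.
suff : m \in msupp (wcomp (mwt m) q) by case: (msupp _).
by rewrite mcoeff_msupp mcoeff_wcomp eqxx -mcoeff_msupp.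
Qed.

End Weights.

(** * Initial forms of families of polynomials *)

(** The component of weight [d] of a polynomial in U, where U has weight [ep]. *)
HB.lock Definition pcomp (k : fieldType) (M : nat) (om : 'I_M -> int)
    (ep d : int) (q : {poly {mpoly k[M]}}) : {poly {mpoly k[M]}} :=
  \poly_(a < size q) wcomp om (d - ep *+ a) q`_a.

Section PolyWeights.
Variables (k : fieldType) (M : nat) (om : 'I_M -> int) (ep : int).
Implicit Types (q : {poly {mpoly k[M]}}) (d : int).

Local Notation pcomp := (@pcomp k M om ep).

Definition pge d q := forall a, wge om (d - ep *+ a) q`_a.

Lemma coef_pcomp d q a : (pcomp d q)`_a = wcomp om (d - ep *+ a) q`_a.
Proof.
by rewrite pcomp.unlock coef_poly; case: ltnP => // h; rewrite nth_default // raddf0.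
Qed.

Lemma pcomp_is_additive d : additive (pcomp d).
Proof.
by move=> q1 q2; apply/polyP => a; rewrite !(coefB, coef_pcomp) raddfB.
Qed.

HB.instance Definition _ d :=
  GRing.isAdditive.Build {poly {mpoly k[M]}} {poly {mpoly k[M]}} (pcomp d)
    (pcomp_is_additive d).

Lemma pcompC d (c : {mpoly k[M]}) : pcomp d c%:P = (wcomp om d c)%:P.
Proof.
apply/polyP => -[|a]; rewrite coef_pcomp [in LHS]coefC [in RHS]coefC /=.
  by rewrite mulr0n subr0.
by rewrite raddf0.
Qed.

Lemma pgeC d (c : {mpoly k[M]}) : wge om d c -> pge d c%:P.
Proof.
move=> h [|a]; rewrite coefC /=; last exact: wge0.
by rewrite mulr0n subr0.
Qed.

Lemma pgeM d1 d2 q1 q2 : pge d1 q1 -> pge d2 q2 -> pge (d1 + d2) (q1 * q2).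
Proof.
move=> h1 h2 a; rewrite coefM; apply: wge_sum => i _.
have -> : d1 + d2 - ep *+ a = (d1 - ep *+ i) + (d2 - ep *+ (a - i)).
  by rewrite -{1}(subnKC (leq_ord i)) mulrnDr; ring.
exact: wgeM.
Qed.

Lemma pcompM d1 d2 q1 q2 : pge d1 q1 -> pge d2 q2 ->
  pcomp (d1 + d2) (q1 * q2) = pcomp d1 q1 * pcomp d2 q2.
Proof.
move=> h1 h2; apply/polyP => a; rewrite coef_pcomp !coefM raddf_sum /=.
apply: eq_bigr => i _; rewrite !coef_pcomp -wcompM //; congr wcomp.
by rewrite -{1}(subnKC (leq_ord i)) mulrnDr; ring.
Qed.

Lemma pcomp_gt d e q : (d < e)%R -> pge e q -> pcomp d q = 0.
Proof.
move=> de qe; apply/polyP => a; rewrite coef_pcomp coef0.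
by apply: wcomp_gt (qe a); lia.
Qed.

End PolyWeights.

(** A morphism [psi] into polynomials in U that does not lower weights
    degenerates to a graded morphism, [initial], which keeps from the image of
    each generator only the part of the same weight. *)
Section Degeneration.
Variables (k : fieldType) (N M : nat).
Variables (om : 'I_M -> int) (ep : int) (omQ : 'I_N -> int).
Variable psi : {rmorphism {mpoly k[N]} -> {poly {mpoly k[M]}}}.
Hypothesis psiC : forall a, psi a%:MP = a%:MP%:P.
Hypothesis psiX : forall j, pge om ep (omQ j) (psi 'X_j).

Definition initial : {mpoly k[N]} -> {poly {mpoly k[M]}} :=
  mmap (polyC \o @mpolyC M k) (fun j => pcomp om ep (omQ j) (psi 'X_j)).

HB.instance Definition _ := GRing.RMorphism.on initial.

Lemma initialC a : initial a%:MP = a%:MP%:P.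
Proof. exact: mmapC. Qed.

Lemma initialX j : initial 'X_j = pcomp om ep (omQ j) (psi 'X_j).
Proof. by rewrite /initial mmapX mmap1U. Qed.

Lemma psi_monomial m :
  pge om ep (mwt omQ m) (psi 'X_[m]) /\
  pcomp om ep (mwt omQ m) (psi 'X_[m]) = initial 'X_[m].
Proof.
have one : pge om ep 0%R 1 /\ pcomp om ep 0%R 1 = 1.
  by split; [apply/pgeC/whom_wge/whomC | rewrite pcompC wcomp_id //; apply: whomC].
have mul d1 d2 q1 q2 r1 r2 : pge om ep d1 q1 /\ pcomp om ep d1 q1 = r1 ->
    pge om ep d2 q2 /\ pcomp om ep d2 q2 = r2 ->
    pge om ep (d1 + d2) (q1 * q2) /\ pcomp om ep (d1 + d2) (q1 * q2) = r1 * r2.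
  by move=> [h1 <-] [h2 <-]; split; [apply: pgeM | apply: pcompM].
rewrite mpolyXE_id mwtE !rmorph_prod.
apply: (big_ind3 (fun d q r => pge om ep d q /\ pcomp om ep d q = r)).
- exact: one.
- by move=> d1 q1 r1 d2 q2 r2; apply: mul.
move=> j _; rewrite !rmorphXn; elim: (m j) => [|n IH]; first by rewrite !expr0; exact: one.
rewrite mulrS !exprS; apply: mul => //.
by split; [exact: psiX | exact: esym (initialX j)].
Qed.

(** The lowest part of the image is the image of the lowest part.  This
    transfers to the degeneration both the relations between the generators and
    the invariance of an element. *)
Lemma initialE d H : wge omQ d H ->
  pcomp om ep d (psi H) = initial (wcomp omQ d H).
Proof.
move=> Hd; rewrite {1}[H]mpolyE !raddf_sum /= wcompE raddf_sum /=.
rewrite [RHS]big_mkcond /= !big_seq; apply: eq_bigr => m mS.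
have [mge mE] := psi_monomial m.
have CE a q : psi (a *: q) = a%:MP%:P * psi q.
  by rewrite -mul_mpolyC rmorphM /= psiC.
have initZ a q : initial (a *: q) = a%:MP%:P * initial q.
  by rewrite -mul_mpolyC [LHS]rmorphM /= initialC.
have aC (a : k) : pge om ep 0%R a%:MP%:P by apply/pgeC/whom_wge/whomC.
rewrite CE; case: eqP => [<-|/eqP ne].
  rewrite initZ -mE -{1}[mwt omQ m]add0r pcompM //.
  rewrite pcompC wcomp_id //.
  exact: (@whomC k M om).
apply: (@pcomp_gt _ _ _ _ _ (0 + mwt omQ m)); last exact: pgeM.
by rewrite add0r lt_neqAle eq_sym ne (wgeP _ _ _ Hd).
Qed.

End Degeneration.

Section GradedSubst.
Variables (k : fieldType) (N M : nat).
Variables (om : 'I_M -> int) (omQ : 'I_N -> int) (g : 'I_N -> {mpoly k[M]}).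
Hypothesis gX : forall j, whom om (omQ j) (g j).

Lemma wcomp_subst d H : wcomp om d (subst g H) = subst g (wcomp omQ d H).
Proof.
elim/mpolyind: H => [|a m q _ _ IH]; first by rewrite !raddf0.
rewrite [subst g (_ + _)]rmorphD !raddfD /= IH; congr (_ + _).
rewrite wcompZ !linearZ /= wcompZ; congr (_ *: _).
have hm : whom om (mwt omQ m) (subst g 'X_[m]).
  rewrite mpolyXE_id rmorph_prod; apply: whom_prod => i.
  by rewrite rmorphXn /= substX; apply: whomXn.
have [<-|/eqP ne] := eqVneq (mwt omQ m) d.
  by rewrite !wcomp_id //; apply: whomXm.
have wz (L : nat) (o : 'I_L -> int) e (q' : {mpoly k[L]}) :
    whom o e q' -> e <> d -> wcomp o d q' = 0.
  move=> /whomP h ed; apply/mpolyP => m'; rewrite mcoeff_wcomp mcoeff0.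
  case: ifP => // /eqP dE; rewrite memN_msupp_eq0 //.
  by apply/negP => /h; rewrite dE => /esym.
by rewrite (wz _ _ _ _ hm ne) (wz _ _ _ _ (@whomXm k _ omQ m) ne) rmorph0.
Qed.

End GradedSubst.

(** * Polynomial curves on the surface with y constant *)

Section PFreeDegree.
Variables (R : idomainType) (p : nat).
Hypothesis pcharRp : p \in [pchar R].
Implicit Types F G X z t : {poly R}.

Local Notation "x ^p" := (x ^+ p) (at level 1, format "x ^p").

(** In a domain of characteristic p this says that c is not a p-th power in the
    fraction field. *)
Definition pfree (c : R) := forall a b : R, c * b^p = a^p -> b = 0.

Let p_gt1 : (1 < p)%N.
Proof. exact: prime_gt1 (pcharf_prime pcharRp). Qed.

Let pchar_polyp : p \in [pchar {poly R}].
Proof. exact: (rmorph_pchar (polyC : {rmorphism R -> {poly R}})). Qed.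

Lemma coef_Frob F i : (F^p)`_(i * p) = (F`_i)^p.
Proof.
have p0 : (0 < p)%N by apply: ltnW.
rewrite -{1}[F]coefK poly_def -(pFrobenius_autE pchar_polyp) rmorph_sum /=.
rewrite coef_sum.
have [iF|iF] := ltnP i (size F).
  rewrite (bigD1 (Ordinal iF)) //= big1 => [|j ji].
    rewrite pFrobenius_autE exprZn -exprM coefZ coefXn.
    by rewrite eqxx mulr_natr mulr1n addr0.
  rewrite pFrobenius_autE exprZn -exprM coefZ coefXn eqn_pmul2r //.
  have -> : (i == j :> nat) = false by rewrite eq_sym; apply: negbTE.
  by rewrite mulr0.
rewrite nth_default // expr0n gtn_eqF // big1 // => j _.
rewrite pFrobenius_autE exprZn -exprM coefZ coefXn eqn_pmul2r //.
by rewrite gtn_eqF ?mulr0 // (leq_trans (ltn_ord j)).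
Qed.

Variable c : R.
Hypothesis c_pfree : pfree c.

(** Coefficients of degree divisible by p cannot cancel between a p-th power
    and [c] times a p-th power. *)
Lemma pfree_coef F G i : (G^p + c%:P * F^p)`_(i * p) = 0 ->
  F`_i = 0 /\ G`_i = 0.
Proof.
rewrite coefD coefCM !coef_Frob => h.
have F0 : F`_i = 0.
  apply: (c_pfree (a := - G`_i)).
  by rewrite (FrobN pcharRp); apply/eqP; rewrite -addr_eq0 addrC h.
split=> //; move/eqP: h; rewrite F0 expr0n gtn_eqF ?mulr0 ?addr0; last by rewrite ltnW.
by rewrite expf_eq0 => /andP[_ /eqP].
Qed.

Lemma pfree_deg_left F G : (p * (size F).-1 <= (size (G^p + c%:P * F^p)%R).-1)%N.
Proof.
have [->|F0] := eqVneq F 0; first by rewrite size_poly0 muln0.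
rewrite -ltnS [X in (_ < X)%N]prednK; last first.
  rewrite size_poly_gt0; apply: contra F0 => /eqP H; apply/eqP/polyP => i.
  by rewrite coef0; apply: (proj1 (@pfree_coef F G i _)); rewrite H coef0.
rewrite ltnNge; apply/negP => /(nth_default 0); rewrite mulnC.
by case/pfree_coef => /eqP; rewrite -lead_coefE lead_coef_eq0 (negbTE F0).
Qed.

Lemma pfree_deg_right F G : (p * (size G).-1 <= (size (G^p + c%:P * F^p)%R).-1)%N.
Proof.
have [->|G0] := eqVneq G 0; first by rewrite size_poly0 muln0.
rewrite -ltnS [X in (_ < X)%N]prednK; last first.
  rewrite size_poly_gt0; apply: contra G0 => /eqP H; apply/eqP/polyP => i.
  by rewrite coef0; apply: (proj2 (@pfree_coef F G i _)); rewrite H coef0.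
rewrite ltnNge; apply/negP => /(nth_default 0); rewrite mulnC.
by case/pfree_coef => _ /eqP; rewrite -lead_coefE lead_coef_eq0 (negbTE G0).
Qed.

(** The surface X^p c = f(z, t), with [c] not a p-th power, contains no
    nonconstant polynomial curve with X nonzero.  The two expressions of s and t
    in the proof bound the degree of each by p times the other. *)
Lemma segre_rigid X z t : X != 0 -> c%:P * X^p = segre p z t ->
  [/\ (size X <= 1)%N, (size z <= 1)%N & (size t <= 1)%N].
Proof.
move=> X0 eqX; set s := segre_s p z t.
have sp : s^p = t + segre p z t.
  by rewrite /s /segre_s /segre !(FrobE pchar_polyp); ring.
have tE : t = s^p + c%:P * (- X)^p.
  by rewrite (FrobN pchar_polyp) mulrN eqX sp addrK.
have sE : s = (z - t * s)^p + c%:P * (t * X)^p.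
  rewrite (FrobB pchar_polyp) !exprMn mulrCA eqX.
  by rewrite sp /s /segre_s; ring.
have degX : (p * (size X).-1 <= (size t).-1)%N.
  by rewrite tE -[in (size X).-1](opprK X) size_polyN; apply: pfree_deg_left.
have degs : (p * (size s).-1 <= (size t).-1)%N.
  by rewrite tE; apply: pfree_deg_right.
have t0 : t != 0.
  apply: contra X0 => /eqP t0; rewrite -oppr_eq0; apply/eqP/polyP => i.
  by rewrite coef0; apply: (proj1 (@pfree_coef _ s i _)); rewrite -tE t0 coef0.
have degtX : (p * ((size t).-1 + (size X).-1) <= (size s).-1)%N.
  have -> : ((size t).-1 + (size X).-1 = (size (t * X)%R).-1)%N.
    by rewrite size_mul //; move: t0 X0; rewrite -!size_poly_gt0; lia.
  by rewrite {1}sE; apply: pfree_deg_left.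
have [s1 t1 X1] : [/\ (size s).-1 = 0, (size t).-1 = 0 & (size X).-1 = 0]%N.
  by split; nia.
have le1 (q : {poly R}) : (size q).-1 = 0%N -> (size q <= 1)%N by case: size => [|[]].
split; [exact: le1 | | exact: le1].
have : (size (z^p)%R <= 1)%N.
  have -> : z^p = s + t^p * t by rewrite /s /segre_s; ring.
  have /size1_polyC-> := le1 _ s1; have /size1_polyC-> := le1 _ t1.
  by rewrite -polyC_exp -polyCM -polyCD size_polyC_leq1.
have [->|z0] := eqVneq z 0; first by rewrite size_poly0.
have : (size (z^p)%R).-1 = ((size z).-1 * p)%N.
  by rewrite size_exp.
nia.
Qed.

End PFreeDegree.

(** * The surface algebra *)

Section Coords.
Variable m : nat.

(** The same four kinds of indices serve for the coordinates u, v, S, x_j of P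
    and for the generators y, t, z, x_j of the surface algebra, in this order. *)
Definition i0 : 'I_m.+3 := @Ordinal m.+3 0 isT.
Definition i1 : 'I_m.+3 := @Ordinal m.+3 1 isT.
Definition i2 : 'I_m.+3 := @Ordinal m.+3 2 isT.
Definition ix (j : 'I_m) : 'I_m.+3 := rshift 3 j.

Lemma ord3_ind (Q : 'I_m.+3 -> Prop) :
  Q i0 -> Q i1 -> Q i2 -> (forall j, Q (ix j)) -> forall i, Q i.
Proof.
move=> Q0 Q1 Q2 Qx i; case: (split_ordP (m := 3) (n := m) i) => [j ->|j ->] //.
by case: j => -[|[|[|]]] //= lt; [move: Q0|move: Q1|move: Q2];
  congr Q; apply: val_inj.
Qed.

Definition coords (T : Type) (a b c : T) (h : 'I_m -> T) (i : 'I_m.+3) : T :=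
  match split (i : 'I_(3 + m)) with
  | inl o => nth a [:: a; b; c] o
  | inr j => h j
  end.

Variables (T : Type) (a b c : T) (h : 'I_m -> T).

Lemma coords0 : coords a b c h i0 = a.
Proof. by rewrite /coords; case: splitP => [[[|j] lt]|j]. Qed.

Lemma coords1 : coords a b c h i1 = b.
Proof. by rewrite /coords; case: splitP => [[[|[|j]] lt]|j]. Qed.

Lemma coords2 : coords a b c h i2 = c.
Proof. by rewrite /coords; case: splitP => [[[|[|[|j]]] lt]|j]. Qed.

Lemma coordsx j : coords a b c h (ix j) = h j.
Proof.
rewrite /coords; case: splitP => [o /= E|j' /= E].
  by have := ltn_ord o; rewrite -E.
by congr h; apply: val_inj; apply: (addnI (esym E)).
Qed.

Definition coordsE := (coords0, coords1, coords2, coordsx).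

End Coords.

(** The generators of k[x_1, ..., x_m, z, t]: the place of y is filled by 0, so
    that the same index set can be used. *)
Definition base_coords (m : nat) (A : nzRingType) (h : 'I_m.+3 -> A) :
    'I_m.+3 -> A :=
  coords 0 (h (i1 m)) (h (i2 m)) (fun j => h (ix j)).

Arguments i0 {m}.
Arguments i1 {m}.
Arguments i2 {m}.

Definition xprod (k : fieldType) (m : nat) : {mpoly k[m.+3]} :=
  \prod_j 'X_(ix j).
(** Sealed, as are the following polynomials, to keep unification from
    expanding them. *)
HB.lock Definition xpow (k : fieldType) (p m e : nat) : {mpoly k[m.+3]} :=
  (xprod k m ^+ e) ^+ p.
HB.lock Definition xpow1 (k : fieldType) (p m e : nat) : {mpoly k[m.+3]} :=
  xpow k p m e ^+ p.-1.
HB.lock Definition ypol (k : fieldType) (p m e : nat) : {mpoly k[m.+3]} :=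
  ycoord p (xpow k p m e) (xpow1 k p m e) 'X_i0 'X_i1 'X_i2.
HB.lock Definition tpol (k : fieldType) (p m e : nat) : {mpoly k[m.+3]} :=
  tcoord p (xpow k p m e) 'X_i1 'X_i2.
HB.lock Definition zpol (k : fieldType) (p m e : nat) : {mpoly k[m.+3]} :=
  zcoord p (xpow k p m e) 'X_i0 'X_i2.
HB.lock Definition wpol (k : fieldType) (p m e : nat) : {mpoly k[m.+3]} :=
  wcoord p (xpow k p m e) (xpow1 k p m e) 'X_i0 'X_i1 'X_i2.

Section Surface.
Variables (k : fieldType) (p : nat) (m e : nat).
Hypothesis pchark : p \in [pchar k].
Local Notation P := {mpoly k[m.+3]}.
Local Notation "x ^p" := (x ^+ p) (at level 1, format "x ^p").

Lemma pchar_mpoly M : p \in [pchar {mpoly k[M]}].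
Proof. exact: (rmorph_pchar (@mpolyC M k : {rmorphism k -> {mpoly k[M]}})). Qed.

Local Notation xprod := (xprod k m).
Local Notation xpow := (xpow k p m e).
Local Notation xpow1 := (xpow1 k p m e).
Local Notation ypol := (ypol k p m e).
Local Notation zpol := (zpol k p m e).
Local Notation tpol := (tpol k p m e).
Local Notation wpol := (wpol k p m e).

Definition gens : 'I_m.+3 -> P := coords ypol tpol zpol (fun j => 'X_(ix j)).

Let p_gt0 : (0 < p)%N.
Proof. exact: prime_gt0 (pcharf_prime pchark). Qed.

Lemma xpow_xpow1 : xpow * xpow1 = xpow^p.
Proof. by rewrite xpow1.unlock -exprS prednK. Qed.

Lemma segre_zpol_tpol : segre p zpol tpol = xpow * ypol.
Proof.
rewrite zpol.unlock tpol.unlock ypol.unlock.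
exact: (segre_coords (pchar_mpoly m.+3) _ _ _ xpow_xpow1).
Qed.

Lemma segre_wpol : 'X_i2 - segre_g p zpol tpol = xpow * wpol.
Proof.
rewrite zpol.unlock tpol.unlock wpol.unlock.
exact: (segre_wcoord (pchar_mpoly m.+3) _ _ _ xpow_xpow1).
Qed.

Lemma xprod_neq0 : xprod != 0.
Proof. by apply/prodf_neq0 => j _; rewrite -msupp_eq0 msuppX. Qed.

Lemma xpow_neq0 : xpow != 0.
Proof. by rewrite xpow.unlock !expf_neq0 // xprod_neq0. Qed.

(** The order along x_i as a weight on P, chosen so that z and t have weight 0:
    then u and v must have weight -ep.  The second weight is the corresponding
    one on presentations of elements by the generators. *)
Definition xorder (i : 'I_m) : 'I_m.+3 -> int :=
  coords (- (e * p)%:Z) (- (e * p)%:Z) 0 (fun j => (j == i)%:Z).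
Definition xorderQ (i : 'I_m) : 'I_m.+3 -> int :=
  coords (- (e * p)%:Z) 0 0 (fun j => (j == i)%:Z).

Lemma whom_xprod i : whom (xorder i) 1%R xprod.
Proof.
have -> : 1%R = \sum_j xorder i (ix j).
  rewrite (bigD1 i) //= big1 => [|j ji]; rewrite /xorder coordsE ?eqxx //.
  by rewrite (negbTE ji).
by apply: whom_prod => j; apply: whomX.
Qed.

Lemma whom_xpow i : whom (xorder i) (e * p)%:Z xpow.
Proof. by rewrite xpow.unlock -exprM -natz; apply: whomXn; apply: whom_xprod. Qed.

(** The surface algebra is graded by each of these orders; y is its only
    generator of negative weight. *)
Lemma whom_gens i j : whom (xorder i) (xorderQ i j) (gens j).
Proof.
have xiW := whom_xpow i; have XW := @whomX k _ (xorder i).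
have powW d q n := @whomXn k _ (xorder i) d q n.
have cast d d' (q : P) : d = d' -> whom (xorder i) d q -> whom (xorder i) d' q by move=> ->.
have S0 : whom (xorder i) 0%R ('X_i2 : P).
  by have := XW i2; rewrite /xorder coordsE.
have UW : whom (xorder i) (- (e * p)%:Z) ('X_i0 : P)
  by have := XW i0; rewrite /xorder coordsE.
have VW : whom (xorder i) (- (e * p)%:Z) ('X_i1 : P)
  by have := XW i1; rewrite /xorder coordsE.
have Sp (q : P) : whom (xorder i) 0%R q -> whom (xorder i) 0%R (q ^p).
  by move=> /(powW _ _ p); rewrite mul0rn.
have M0 (q1 q2 : P) : whom (xorder i) 0%R q1 -> whom (xorder i) 0%R q2 ->
    whom (xorder i) 0%R (q1 * q2).
  by move=> h1 h2; rewrite -[0]addr0; apply: whomM.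
have xiv (q : P) : whom (xorder i) (- (e * p)%:Z) q -> whom (xorder i) 0%R (xpow * q).
  by move=> h; apply: cast (whomM xiW h); rewrite subrr.
elim/ord3_ind: j => [||| j]; rewrite /gens /xorderQ !coordsE.
- have cW : whom (xorder i) ((e * p)%:Z *+ p.-1) xpow1
    by rewrite xpow1.unlock; apply: powW.
  rewrite ypol.unlock /ycoord; set r := (e * p)%:Z in xiW UW VW xiv cW *.
  have nE : r *+ p = r *+ p.-1 + r by rewrite -mulrSr prednK.
  have cp (q : P) d : whom (xorder i) d q -> whom (xorder i) (d *+ p) (q^p) by apply: powW.
  have Sn (q1 q2 : P) d : whom (xorder i) d q1 -> whom (xorder i) 0%R q2 ->
      whom (xorder i) d (q1 * q2).
    by move=> h1 h2; rewrite -[d]addr0; apply: whomM.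
  have v1 : whom (xorder i) (- r) (xpow1 * ('X_i1)^p).
    by apply: cast (whomM cW (cp _ _ VW)); rewrite mulNrn nE; ring.
  have c2 : whom (xorder i) (r *+ p *+ p - r) (xpow1^p * xpow1).
    apply: cast (whomM (cp _ _ cW) cW).
    by rewrite [r *+ p]nE mulrnDl nE; ring.
  have vpp (q : P) : whom (xorder i) (- r) q -> whom (xorder i) (- (r *+ p *+ p)) (q^p^p).
    by move=> h; apply: cast (cp _ _ (cp _ _ h)); rewrite !mulNrn.
  have v2 (q : P) : whom (xorder i) (- r) q ->
      whom (xorder i) (- r) (xpow1^p * xpow1 * q^p^p).
    by move=> h; apply: cast (whomM c2 (vpp _ h)); ring.
  have v3 : whom (xorder i) (- r) (xpow^p^p * xpow1 * ('X_i1)^p^p * ('X_i1)^p).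
    have h : whom (xorder i) 0%R (xpow^p^p * ('X_i1)^p^p).
      by apply: cast (whomM (cp _ _ (cp _ _ xiW)) (vpp _ VW)); rewrite subrr.
    have -> : xpow^p^p * xpow1 * ('X_i1)^p^p * ('X_i1)^p
      = xpow1 * ('X_i1)^p * (xpow^p^p * ('X_i1)^p^p) by ring.
    exact: Sn.
  apply: whomB v3; apply: whomB; last by apply: Sn; [exact: v2 | do 3!apply/Sp].
  by apply: whomB; [apply: whomB (v2 _ UW) VW | apply: Sn => //; do 4!apply/Sp].
- rewrite tpol.unlock.
  by apply: whomD; [exact: xiv | do 2!apply/Sp].
- rewrite zpol.unlock; apply: whomD; last by apply: M0; do ?apply/Sp.
  by apply: whomD => //; apply: xiv.
- by have := XW (ix j); rewrite /xorder coordsE.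
Qed.

End Surface.

(** * Minimal representations, derivations and specialisations *)

(** A presentation with the least number of monomials contains no homogeneous
    part that evaluates to 0, for any of the gradings at once; so its monomials
    have no weight lower than the element it presents. *)
Lemma minimal_representation (k : fieldType) (N M : nat) (I : Type)
    (om : I -> 'I_M -> int) (omQ : I -> 'I_N -> int) (g : 'I_N -> {mpoly k[M]})
    (gh : forall i j, whom (om i) (omQ i j) (g j)) (H0 : {mpoly k[N]}) :
  exists2 H, subst g H = subst g H0 &
    forall i d, wge (om i) d (subst g H0) -> wge (omQ i) d H.
Proof.
move: {2}(size (msupp H0)) (leqnn (size (msupp H0))) => n.
elim: n => [|n IH] in H0 * => sH.
  exists H0 => // i d _; apply/wgeP => m.
  by move: sH; rewrite leqn0 => /nilP ->.
have [[i [m [mH c0]]]|none] := pselect (exists i m, m \in msupp H0 /\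
    wcomp (om i) (mwt (omQ i) m) (subst g H0) = 0); last first.
  exists H0 => // i d hd; apply/wgeP => m mH.
  rewrite leNgt; apply/negP => lt; apply: none; exists i, m; split=> //.
  exact: wcomp_gt lt hd.
pose H' := H0 - wcomp (omQ i) (mwt (omQ i) m) H0.
have eqH : subst g H' = subst g H0.
  by rewrite raddfB /= -(wcomp_subst (gh i)) c0 subr0.
rewrite -eqH; apply: IH; rewrite -ltnS.
apply: leq_trans sH; rewrite -(prednK (n := size (msupp H0))); last first.
  by case: (msupp H0) mH.
rewrite ltnS -(size_rem mH); apply: uniq_leq_size => // m'.
rewrite (mem_rem_uniq _ (msupp_uniq _)) !inE !mcoeff_msupp mcoeffB mcoeff_wcomp.
case: ifP => [_|ne]; first by rewrite subrr eqxx.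
by rewrite subr0 => ->; rewrite andbT; apply: contraFN ne => /eqP ->.
Qed.

Lemma mpoly_factorX (k : fieldType) (N : nat) (i : 'I_N) (q : {mpoly k[N]}) :
  (forall m, m \in msupp q -> (0 < m i)%N) -> exists q', q = 'X_i * q'.
Proof.
move=> qi; exists (\sum_(m <- msupp q) q@_m *: 'X_[(m - U_(i))%MM]).
rewrite mulr_sumr {1}[q]mpolyE; rewrite !big_seq; apply: eq_bigr => m /qi mi.
rewrite -scalerAr -mpolyXD addmC submK //; apply/mnm_lepP => j.
by rewrite mnm1E; case: eqP => [<-|].
Qed.

Section PDerivation.
Variables (k : fieldType) (p : nat) (M : nat) (i : 'I_M).
Hypothesis pchark : p \in [pchar k].
Implicit Types a b q : {mpoly k[M]}.

Lemma mderiv_exp0 q n : mderiv i q = 0 -> mderiv i (q ^+ n) = 0.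
Proof.
move=> q0; elim: n => [|n IH]; first by rewrite expr0 -mpolyC1 mderivC.
by rewrite exprS mderivM q0 IH mul0r mulr0 addr0.
Qed.

Lemma mderiv_mul0 a b : mderiv i a = 0 -> mderiv i b = 0 ->
  mderiv i (a * b) = 0.
Proof. by move=> a0 b0; rewrite mderivM a0 b0 mul0r mulr0 addr0. Qed.

Lemma mderiv_Frob q : mderiv i (q ^+ p) = 0.
Proof.
have deriv_exp n : mderiv i (q ^+ n.+1) = mderiv i q * q ^+ n *+ n.+1.
  elim: n => [|n IH]; first by rewrite expr1 expr0 mulr1 mulr1n.
  by rewrite exprS mderivM IH [in RHS]mulrS exprS; ring.
have p0 := prime_gt0 (pcharf_prime pchark).
rewrite -(prednK p0) deriv_exp prednK // -mulr_natr.
by rewrite (pcharf0 (pchar_mpoly pchark M)) mulr0.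
Qed.

Lemma mderiv_ycoord (x c u v S : {mpoly k[M]}) :
  mderiv i c = 0 ->
  mderiv i (ycoord p x c u v S) = - mderiv i v.
Proof.
move=> Dc.
have D0 a b : mderiv i a = 0 -> mderiv i b = 0 -> mderiv i (a * b) = 0.
  exact: mderiv_mul0.
have Dsum a b b' b'' : mderiv i a = 0 -> mderiv i b = 0 -> mderiv i b' = 0 ->
    mderiv i b'' = 0 -> mderiv i (a - v - b - b' - b'') = - mderiv i v.
  by move=> h h1 h2 h3; rewrite !mderivB h h1 h2 h3 sub0r !subr0.
have DF := mderiv_Frob.
have Dc2 : mderiv i (c ^+ p * c) = 0 := D0 _ _ (DF _) Dc.
apply: Dsum.
- exact: D0 Dc2 (DF _).
- exact: D0 (D0 _ _ Dc (DF _)) (DF _).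
- exact: D0 (D0 _ _ Dc2 (DF _)) (DF _).
- exact: D0 (D0 _ _ (D0 _ _ (DF _) Dc) (DF _)) (DF _).
Qed.

End PDerivation.

Section RmorphCoords.
Variables (R S : comNzRingType) (f : {rmorphism R -> S}) (p : nat).

Lemma rmorph_ycoord x c u v s :
  f (ycoord p x c u v s) = ycoord p (f x) (f c) (f u) (f v) (f s).
Proof. by rewrite /ycoord !rmorphB !rmorphM !rmorphXn. Qed.

Lemma rmorph_zcoord x u s : f (zcoord p x u s) = zcoord p (f x) (f u) (f s).
Proof. by rewrite /zcoord !rmorphD !rmorphM !rmorphXn. Qed.

Lemma rmorph_tcoord x v s : f (tcoord p x v s) = tcoord p (f x) (f v) (f s).
Proof. by rewrite /tcoord rmorphD !rmorphM !rmorphXn. Qed.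

Lemma rmorph_segre z t : f (segre p z t) = segre p (f z) (f t).
Proof. by rewrite /segre !rmorphB !rmorphM !rmorphXn. Qed.

Lemma rmorph_segre_g z t : f (segre_g p z t) = segre_g p (f z) (f t).
Proof.
by rewrite /segre_g /segre_s !(rmorphB, rmorphM, rmorphXn).
Qed.

Lemma rmorph_ushift c y W : f (ushift p c y W) = ushift p (f c) (f y) (f W).
Proof. by rewrite /ushift rmorphD !rmorphM !rmorphXn. Qed.

Lemma rmorph_vshift x c t y W :
  f (vshift p x c t y W) = vshift p (f x) (f c) (f t) (f y) (f W).
Proof. by rewrite /vshift !rmorphB !rmorphM !rmorphXn. Qed.

End RmorphCoords.

Section SurfaceFacts.
Variables (k : fieldType) (p : nat) (m e : nat).
Hypotheses (pchark : p \in [pchar k]) (e_gt0 : (0 < e)%N).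
Local Notation P := {mpoly k[m.+3]}.
Local Notation ypol := (ypol k p m e).
Local Notation zpol := (zpol k p m e).
Local Notation tpol := (tpol k p m e).
Local Notation xpow := (xpow k p m e).
Local Notation xpow1 := (xpow1 k p m e).
Local Notation gens := (@gens k p m e).
Local Notation Dv := (mderiv (@i1 m)).

Let p_gt1 : (1 < p)%N.
Proof. exact: prime_gt1 (pcharf_prime pchark). Qed.

Lemma mderiv_ypol : Dv ypol = - 1.
Proof.
have DF q := mderiv_Frob (@i1 m) pchark q.
have -> : - 1 = - Dv ('X_i1 : P).
  by rewrite mderivX mnm1E eqxx -{1}[U_(_)%MM]add0m addmK mpolyX0 scale1r.
rewrite ypol.unlock; apply: mderiv_ycoord => //.
by rewrite xpow1.unlock xpow.unlock; apply/mderiv_exp0/DF.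
Qed.

(** The derivative of y with respect to v is -1, while p-th powers have
    derivative 0. *)
Lemma pfree_ypol : pfree p ypol.
Proof.
move=> a b eq_ab; have := mderiv_Frob (@i1 m) pchark a.
rewrite -eq_ab mderivM mderiv_ypol mderiv_Frob // mulr0 addr0 mulN1r => /eqP.
by rewrite oppr_eq0 expf_eq0 => /andP[_ /eqP].
Qed.

Definition kill (A : pred 'I_m.+3) : P -> P :=
  subst (fun i => if A i then 0 else 'X_i).

HB.instance Definition _ A := GRing.LRMorphism.on (kill A).

Lemma killX A i : kill A 'X_i = if A i then 0 else 'X_i.
Proof. exact: substX. Qed.

Variables (A : pred 'I_m.+3) (j : 'I_m).
Hypothesis Aj : A (ix j).

Lemma kill_xpow : kill A xpow = 0.
Proof.
rewrite xpow.unlock !rmorphXn /= /xprod rmorph_prod (bigD1 j) //= killX Aj mul0r.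
by rewrite !expr0n eqn0Ngt e_gt0 mulr0n expr0n eqn0Ngt ltnW.
Qed.

(** Every other term of y is a multiple of x. *)
Lemma kill_ypol : kill A ypol = - kill A 'X_i1.
Proof.
have c0 : kill A xpow1 = 0.
  rewrite xpow1.unlock rmorphXn /= kill_xpow expr0n.
  by case: (p) p_gt1 => [|[]].
by rewrite ypol.unlock rmorph_ycoord /= c0 kill_xpow ycoord0 // ltnW.
Qed.

Lemma mderiv_kill_var i : i != i1 -> Dv (kill A 'X_i) = 0.
Proof.
move=> ne; rewrite killX; case: ifP => _; first by rewrite mderiv0.
by rewrite mderivX mnm1E (negbTE ne) scale0r.
Qed.

(** Modulo x_j the elements z and t become polynomials in S alone. *)
Lemma mderiv_kill_base i : Dv (kill A (base_coords gens i)) = 0.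
Proof.
have D0 (a b : P) : Dv a = 0 -> Dv b = 0 -> Dv (a * b) = 0.
  exact: mderiv_mul0.
have S0 : Dv (kill A 'X_i2) = 0 by apply: mderiv_kill_var.
elim/ord3_ind: i => [||| l]; rewrite /base_coords /gens !coordsE.
- by rewrite rmorph0 mderiv0.
- rewrite tpol.unlock rmorph_tcoord /= kill_xpow /tcoord mul0r add0r.
  exact: mderiv_Frob.
- rewrite zpol.unlock rmorph_zcoord /= kill_xpow /zcoord mul0r add0r mderivD S0.
  by rewrite add0r; apply: D0; apply: mderiv_Frob.
- exact: mderiv_kill_var.
Qed.

End SurfaceFacts.

(** * Rigidity *)

(** For points (a, delta), the least value of delta / a, compared without
    division. *)
Lemma minimal_slope (L : seq (nat * int)) : L != [::] ->
  (forall x, x \in L -> (0 < x.1)%N) ->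
  exists2 x, x \in L & forall y, y \in L -> (x.2 *+ y.1 <= y.2 *+ x.1)%R.
Proof.
elim: L => // x L IH _ pos.
have [L0|L0] := eqVneq L [::].
  by exists x; rewrite ?mem_head // L0 => y; rewrite inE => /eqP ->.
have [z zL|y yL ymin] := IH L0; first by apply: pos; rewrite inE zL orbT.
have posL z : z \in L -> (0 < z.1)%N by move=> zL; apply: pos; rewrite inE zL orbT.
have [le|lt] := lerP (x.2 *+ y.1) (y.2 *+ x.1).
  exists x; rewrite ?mem_head // => z; rewrite inE => /orP[/eqP -> //|zL].
  rewrite -(ler_pMn2r (posL _ yL)) mulrnAC; have := ymin _ zL => le2.
  apply: le_trans (_ : y.2 *+ x.1 *+ z.1 <= _)%R; first by rewrite ler_wMn2r.
  by rewrite mulrnAC (mulrnAC z.2) ler_wMn2r.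
exists y; first by rewrite inE yL orbT.
by move=> z; rewrite inE => /orP[/eqP -> |/ymin //]; apply: ltW.
Qed.

Section ScaledWeights.
Variables (k : fieldType) (M : nat) (om : 'I_M -> int) (n : nat).
Hypothesis n_gt0 : (0 < n)%N.
Let om' l := om l *+ n.

Lemma mwt_scale m : mwt om' m = mwt om m *+ n.
Proof. by rewrite /mwt -sumrMnl; apply: eq_bigr => l _; rewrite mulrnAC. Qed.

Lemma wge_scale d (q : {mpoly k[M]}) : wge om' (d *+ n) q = wge om d q.
Proof. by apply: eq_all => m; rewrite mwt_scale ler_pMn2r. Qed.

Lemma whom_scale d (q : {mpoly k[M]}) : whom om' (d *+ n) q = whom om d q.
Proof. by apply: eq_all => m; rewrite mwt_scale eqr_pMn2r. Qed.

Lemma wcomp_scale d (q : {mpoly k[M]}) : wcomp om' (d *+ n) q = wcomp om d q.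
Proof.
by apply/mpolyP => m; rewrite !mcoeff_wcomp mwt_scale eqr_pMn2r.
Qed.

End ScaledWeights.

Lemma size_factor (R : idomainType) (a b : {poly R}) :
  a * b != 0 -> (size (a * b)%R <= 1)%N -> (size a <= 1)%N.
Proof.
rewrite mulf_eq0 negb_or => /andP[a0 b0]; rewrite size_mul //.
by move: a0 b0; rewrite -!size_poly_gt0; case: (size a) (size b) => [|x] [|y] //=; lia.
Qed.

(** The morphism psi is a deformation phi of the surface algebra seen on
    presentations; being well defined on the algebra is [psi_factor]. *)
Section Rigidity.
Variables (k : fieldType) (p : nat) (m e : nat).
Hypotheses (pchark : p \in [pchar k]) (e_gt0 : (0 < e)%N).
Local Notation P := {mpoly k[m.+3]}.
Local Notation gens := (@gens k p m e).
Local Notation om := (@xorder p m e).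
Local Notation omQ := (@xorderQ p m e).

Variable psi : {rmorphism {mpoly k[m.+3]} -> {poly P}}.
Hypothesis psiC : forall a, psi a%:MP = a%:MP%:P.
Hypothesis psi_coef0 : forall H, (psi H)`_0 = subst gens H.
Hypothesis psi_factor : forall H H',
  subst gens H = subst gens H' -> psi H = psi H'.

Lemma whomQ_relation i :
  whom (omQ i) 0%R (xpow k p m e * 'X_i0 - segre p 'X_i2 'X_i1).
Proof.
have XW := @whomX k _ (omQ i).
have Sp (q : P) : whom (omQ i) 0%R q -> whom (omQ i) 0%R (q ^+ p).
  by move=> /whomXn -/(_ p); rewrite mul0rn.
have Z0 : whom (omQ i) 0%R ('X_i2 : P) by have := XW i2; rewrite /xorderQ coordsE.
have T0 : whom (omQ i) 0%R ('X_i1 : P) by have := XW i1; rewrite /xorderQ coordsE.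
have xW : whom (omQ i) 1%R (xprod k m).
  have -> : 1%R = \sum_j omQ i (ix j).
    rewrite (bigD1 i) //= big1 => [|j ji]; rewrite /xorderQ coordsE ?eqxx //.
    by rewrite (negbTE ji).
  by apply: whom_prod => j; apply: whomX.
have xiW : whom (omQ i) (e * p)%:Z (xpow k p m e).
  by rewrite xpow.unlock -exprM -natz; apply: whomXn.
apply: whomB.
  have -> : 0%R = (e * p)%:Z + omQ i i0 by rewrite /xorderQ coordsE subrr.
  exact: whomM.
apply: whomB; first by apply: whomB T0; do 2!apply/Sp.
by rewrite -[0%R]addr0; apply: whomM; do ?apply/Sp.
Qed.

Lemma subst_xprod : subst gens (xprod k m) = xprod k m.
Proof.
rewrite /xprod rmorph_prod; apply: eq_bigr => j _.
by rewrite /= substX /gens coordsE.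
Qed.

Lemma subst_relation :
  subst gens (xpow k p m e * 'X_i0 - segre p 'X_i2 'X_i1) = 0.
Proof.
have xE : subst gens (xpow k p m e) = xpow k p m e.
  by rewrite xpow.unlock !rmorphXn /= subst_xprod.
rewrite rmorphB rmorphM /= rmorph_segre /= xE !substX /gens !coordsE.
by rewrite segre_zpol_tpol // subrr.
Qed.

(** Points (a, delta) record that the image of some generator contains U^a with
    a coefficient of weight delta above that of the generator.  Giving U minus the
    least slope as weight makes psi weight-nondecreasing while some term with U
    survives in the degeneration.  Weights are multiplied by [a0] to clear the
    denominator of the slope. *)
Lemma slope_exists i : (exists j, psi 'X_j != (gens j)%:P) ->
  exists a0 : nat, exists d0 : int, [/\ (0 < a0)%N,
    forall j, pge (fun l => om i l *+ a0) (- d0) (omQ i j *+ a0) (psi 'X_j) &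
    exists j, wcomp (om i) (omQ i j + d0) (psi 'X_j)`_a0 != 0].
Proof.
move=> [j0 nontriv].
pose slopes j a :=
  [seq (a, mwt (om i) mu - omQ i j) | mu <- msupp (psi 'X_j)`_a].
pose L := flatten [seq flatten [seq slopes j a | a <- iota 1 (size (psi 'X_j))]
  | j <- enum 'I_m.+3].
have memL j a mu : (0 < a)%N -> mu \in msupp (psi 'X_j)`_a ->
    (a, mwt (om i) mu - omQ i j) \in L.
  move=> a0 muS; apply/flatten_mapP; exists j; first by rewrite mem_enum.
  apply/flatten_mapP; exists a; last by apply/mapP; exists mu.
  rewrite mem_iota a0 add1n ltnS /=.
  rewrite leqNgt; apply/negP => lt.
  by move: muS; rewrite nth_default ?msupp0 // ltnW.
have Lmem x : x \in L -> exists j a mu,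
    [/\ (0 < a)%N, mu \in msupp (psi 'X_j)`_a & x = (a, mwt (om i) mu - omQ i j)].
  case/flatten_mapP => j _ /flatten_mapP[a]; rewrite mem_iota => /andP[a0 _].
  by case/mapP => mu muS ->; exists j, a, mu.
have Lpos x : x \in L -> (0 < x.1)%N by case/Lmem => j [a [mu [a0 _ ->]]].
have LN0 : L != [::].
  have [a a0 ca] : exists2 a, (0 < a)%N & (psi 'X_j0)`_a != 0.
    have [//|h] := pselect (exists2 a, (0 < a)%N & (psi 'X_j0)`_a != 0).
    case/eqP: nontriv; apply/polyP => -[|a].
      by rewrite psi_coef0 substX [in RHS]coefC.
    rewrite [in RHS]coefC /=; apply/eqP; rewrite -[_ == _]negbK.
    by apply/negP => ca; apply: h; exists a.+1.
  have : exists mu, mu \in msupp (psi 'X_j0)`_a.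
    move: ca; rewrite -msupp_eq0; case: (msupp _) => // mu s _.
    by exists mu; apply: mem_head.
  by case=> mu /(memL _ _ _ a0); case: (L).
have [[a0 d0] xL xmin] := minimal_slope LN0 Lpos.
exists a0, d0; split; first exact: Lpos xL.
  move=> j [|a]; apply/wgeP => mu muS; rewrite mwt_scale.
    move: muS; rewrite psi_coef0 substX mulr0n subr0.
    by move/(whomP _ _ _ (whom_gens e pchark i j)) ->.
  have := xmin _ (memL _ _ _ (ltn0Sn a) muS); rewrite /= mulNrn opprK mulrnBl.
  by rewrite -lerBrDl.
case/Lmem: xL => j [a [mu [_ muS [a0E d0E]]]]; exists j.
apply/eqP => /(congr1 (mcoeff mu)); rewrite mcoeff_wcomp mcoeff0 d0E addrC subrK.
by rewrite eqxx => /eqP; rewrite a0E -[_ == _]negbK -mcoeff_msupp muS.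
Qed.

(** The degenerated morphism fixes y as soon as a fixed element has a pole,
    and then it is constant by [segre_rigid]. *)
Lemma invariant_weight H i : (exists j, psi 'X_j != (gens j)%:P) ->
  psi H = (subst gens H)%:P -> wge (om i) 0%R (subst gens H).
Proof.
move=> nontriv inv; have gh := @whom_gens k p m e pchark.
have [a0 [d0 [a0_gt0 psiX [j1 j1N0]]]] := slope_exists i nontriv.
set om' := (fun l => om i l *+ a0) in psiX.
pose omQ' l := omQ i l *+ a0.
pose ini : {rmorphism {mpoly k[m.+3]} -> {poly P}} :=
  initial om' (- d0) omQ' psi.
have iniE d H' : wge omQ' d H' ->
    pcomp om' (- d0) d (psi H') = ini (wcomp omQ' d H').
  exact: initialE.
have ini0 j : (ini 'X_j)`_0 = gens j.
  have -> : ini 'X_j = pcomp om' (- d0) (omQ' j) (psi 'X_j) := initialX _ _ _ _ _.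
  rewrite coef_pcomp mulr0n subr0 psi_coef0 substX wcomp_id //.
  by rewrite whom_scale.
have [->|h0] := eqVneq (subst gens H) 0; first exact: wge0.
have [d [hd hdN0]] := wlow_exists (om i) h0.
have [d_ge0|d_lt0] := lerP 0 d; first exact: wgeW hd.
have [H1 H1E H1w] := minimal_representation gh H.
have Hd : wge omQ' (d *+ a0) H1 by rewrite wge_scale //; apply: H1w.
(* Monomials without y have nonnegative weight. *)
have [H2 H2E] : exists H2, wcomp omQ' (d *+ a0) H1 = 'X_i0 * H2.
  apply: mpoly_factorX => mu.
  move/(whomP _ _ _ (whom_wcomp _ _ _)); rewrite mwt_scale => /eqP.
  rewrite eqr_pMn2r // lt0n => /eqP mud; apply: contraTneq d_lt0 => mu0.
  rewrite -leNgt -mud /mwt; apply: sumr_ge0 => l _.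
  elim/ord3_ind: l => [||| j]; rewrite ?mu0 ?mulr0n // /xorderQ coordsE ?mul0rn //.
  by rewrite mulrn_wge0.
have lowE : ini 'X_i0 * ini H2 = (wcomp (om i) d (subst gens H))%:P.
  rewrite -[LHS]rmorphM -H2E -(iniE _ _ Hd) (psi_factor H1E) inv.
  by rewrite pcompC wcomp_scale.
(* The product of the images of y and H2 does not involve U, so neither factor
   does; and at U = 0 nothing has changed. *)
have iniY : ini 'X_i0 = (ypol k p m e)%:P.
  have /size1_polyC -> : (size (ini 'X_i0) <= 1)%N.
    apply: (@size_factor _ _ (ini H2)); rewrite lowE ?size_polyC_leq1 //.
    by rewrite polyC_eq0.
  by rewrite ini0 /gens coordsE.
have ini_coef0 H' : (ini H')`_0 = subst gens H'.
  rewrite -horner_coef0 -[LHS]/((horner_eval 0 \o ini) H').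
  apply: mpoly_rmorph_ext => [a|j]; rewrite /= /horner_eval horner_coef0.
    have -> : ini a%:MP = a%:MP%:P := initialC _ _ _ _ _.
    by rewrite substC alg_mpolyC coefC.
  by rewrite ini0 substX.
pose X := ini (xprod k m ^+ e).
have X_neq0 : X != 0.
  apply: contraNneq (expf_neq0 e (xprod_neq0 k m)) => X0.
  have := ini_coef0 (xprod k m ^+ e); rewrite -/X X0 coef0 rmorphXn /= subst_xprod.
  by move=> <-.
have segreX : (ypol k p m e)%:P * X ^+ p = segre p (ini 'X_i2) (ini 'X_i1).
  have := iniE 0%R (xpow k p m e * 'X_i0 - segre p 'X_i2 'X_i1).
  rewrite (psi_factor (H' := 0)) ?subst_relation ?rmorph0 //.
  have hrel : whom omQ' 0%R (xpow k p m e * 'X_i0 - segre p 'X_i2 'X_i1).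
    by rewrite -[0%R](mul0rn _ a0) whom_scale // whomQ_relation.
  rewrite raddf0 wcomp_id // => /(_ (whom_wge hrel))/esym/eqP.
  rewrite rmorphB rmorphM /= subr_eq0 iniY.
  have iniS : ini (segre p 'X_i2 'X_i1) = segre p (ini 'X_i2) (ini 'X_i1) :=
    rmorph_segre ini p _ _.
  have iniXpow : ini (xpow k p m e) = X ^+ p by rewrite xpow.unlock; exact: rmorphXn.
  by move/eqP; rewrite iniS iniXpow => <-; exact: mulrC.
have pcharP := pchar_mpoly pchark m.+3.
have [szX szZ szT] := segre_rigid pcharP (@pfree_ypol k p m e pchark) X_neq0 segreX.
have sz j : (size (ini 'X_j) <= 1)%N.
  elim/ord3_ind: j => [||| j]; [|exact: szT|exact: szZ|].
    by rewrite iniY size_polyC_leq1.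
  have [R XE] : exists R, X = ini 'X_(ix j) * R.
    exists (ini (\prod_(l | l != j) 'X_(ix l) * xprod k m ^+ e.-1)).
    rewrite -rmorphM /= /X mulrA; congr (ini _).
    by rewrite -[in LHS](prednK e_gt0) exprS {1}/xprod (bigD1 j).
  by apply: (@size_factor _ _ R); rewrite -XE.
(* The term with U^a0 that determined the slope would survive. *)
move: j1N0; rewrite -(wcomp_scale _ a0_gt0) => /negP[]; apply/eqP.
have := coef_pcomp om' (- d0) (omQ' j1) (psi 'X_j1) a0.
have <- : ini 'X_j1 = _ := initialX _ _ _ _ _.
rewrite nth_default; last first.
  by apply: leq_trans (sz j1) _.
by rewrite mulNrn opprK mulrnDl => /esym; exact.
Qed.

End Rigidity.

(** * The polynomial ring over the surface algebra *)

HB.lock Definition xC (k : fieldType) (p m e : nat) : im_alg (@gens k p m e) :=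
  \prod_j im_gen _ (ix j).
HB.lock Definition xpowC (k : fieldType) (p m e : nat) : im_alg (@gens k p m e) :=
  (xC k p m e ^+ e) ^+ p.
HB.lock Definition xpow1C (k : fieldType) (p m e : nat) : im_alg (@gens k p m e) :=
  xpowC k p m e ^+ p.-1.

Section StableIsomorphism.
Variables (k : fieldType) (p : nat) (m e : nat).
Hypothesis pchark : p \in [pchar k].
Local Notation P := {mpoly k[m.+3]}.
Local Notation gens := (@gens k p m e).
Local Notation xpow := (xpow k p m e).
Local Notation C := (im_alg gens).
Local Notation cg := (im_gen gens).
Local Notation cval := (@im_val k m.+3 m.+3 gens).

Local Notation xC := (xC k p m e).
Local Notation xpowC := (xpowC k p m e).
Local Notation xpow1C := (xpow1C k p m e).

Lemma xCE : xC = \prod_j cg (ix j).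
Proof. by rewrite xC.unlock. Qed.

Lemma cval_x : cval xC = xprod k m.
Proof.
rewrite xCE /xprod rmorph_prod; apply: eq_bigr => j _.
by rewrite /= im_val_gen /gens coordsE.
Qed.

Lemma cval_xpow : cval xpowC = xpow.
Proof. by rewrite xpowC.unlock !rmorphXn /= cval_x xpow.unlock. Qed.

Lemma cval_xpow1 : cval xpow1C = xpow1 k p m e.
Proof. by rewrite xpow1C.unlock rmorphXn /= cval_xpow xpow1.unlock. Qed.

Lemma cval_gen0 : cval (cg i0) = ypol k p m e.
Proof. by rewrite im_val_gen /gens coordsE. Qed.

Lemma cval_gen1 : cval (cg i1) = tpol k p m e.
Proof. by rewrite im_val_gen /gens coordsE. Qed.

Lemma cval_gen2 : cval (cg i2) = zpol k p m e.
Proof. by rewrite im_val_gen /gens coordsE. Qed.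

Lemma cval_genx j : cval (cg (ix j)) = 'X_(ix j).
Proof. by rewrite im_val_gen /gens coordsE. Qed.

Lemma xpowC_xpow1C : xpowC * xpow1C = xpowC ^+ p.
Proof.
apply: im_val_inj; rewrite rmorphM rmorphXn /= cval_xpow cval_xpow1.
exact: xpow_xpow1.
Qed.

Lemma xpowC_yC : xpowC * cg i0 = segre p (cg i2) (cg i1).
Proof.
apply: im_val_inj; rewrite rmorphM rmorph_segre /= cval_xpow.
by rewrite cval_gen0 cval_gen1 cval_gen2 segre_zpol_tpol.
Qed.

Lemma xpowC_cancel (c c' : C) : xpowC * c = xpowC * c' -> c = c'.
Proof.
move=> /(congr1 cval); rewrite !rmorphM /= cval_xpow => h.
by apply/im_val_inj/(mulfI (xpow_neq0 k p m e)).
Qed.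

Lemma xpowCP_cancel (q q' : {poly C}) : xpowC%:P * q = xpowC%:P * q' -> q = q'.
Proof.
move=> h; apply/polyP => i; apply: xpowC_cancel.
by rewrite -!coefCM h.
Qed.

Lemma pchar_polyC : p \in [pchar {poly C}].
Proof.
exact: (rmorph_pchar (polyC \o in_alg C : {rmorphism k -> {poly C}})).
Qed.

Let cvalX_comm : commr_rmorph cval (wpol k p m e).
Proof. by move=> c; apply: mulrC. Qed.

(** The inclusion of the surface algebra in P, extended by sending the new
    variable to w = (S - g(z, t)) / x^(ep). *)
Definition to_poly : {poly C} -> P := horner_morph cvalX_comm.
HB.instance Definition _ := GRing.RMorphism.on to_poly.

Lemma to_polyC c : to_poly c%:P = cval c.
Proof. exact: horner_morphC. Qed.

Lemma to_polyX : to_poly 'X = wpol k p m e.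
Proof. exact: horner_morphX. Qed.

Let z := (cg i2)%:P : {poly C}.
Let t := (cg i1)%:P : {poly C}.
Let y := (cg i0)%:P : {poly C}.
Let SS : {poly C} := xpowC%:P * 'X + segre_g p z t.
Let vv : {poly C} := vcoord p xpowC%:P xpow1C%:P z t y 'X.
Let uu : {poly C} := ucoord p xpowC%:P xpow1C%:P z t y 'X.

Let xpow1_rel : xpowC%:P * xpow1C%:P = xpowC%:P ^+ p :> {poly C}.
Proof. by rewrite -polyCM xpowC_xpow1C polyC_exp. Qed.

Let xiy_rel : xpowC%:P * y = segre p z t.
Proof.
by rewrite -[RHS](rmorph_segre (polyC : {rmorphism C -> {poly C}})) -xpowC_yC /= polyCM.
Qed.

(** The inverse: S, u and v go to the coordinates of the straightened line over
    the surface algebra. *)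
Definition of_poly : P -> {poly C} :=
  mmap (polyC \o in_alg C) (coords uu vv SS (fun j => (cg (ix j))%:P)).
HB.instance Definition _ := GRing.RMorphism.on of_poly.

Lemma of_polyC a : of_poly a%:MP = (a%:A)%:P.
Proof. exact: mmapC. Qed.

Lemma of_polyX i :
  of_poly 'X_i = coords uu vv SS (fun j => (cg (ix j))%:P) i.
Proof. by rewrite /of_poly mmapX mmap1U. Qed.

Lemma of_poly_xpow : of_poly xpow = xpowC%:P.
Proof.
rewrite xpow.unlock !rmorphXn /= /xprod rmorph_prod /= xpowC.unlock xCE !polyC_exp.
congr (_ ^+ _ ^+ _); rewrite rmorph_prod; apply: eq_bigr => j _ /=.
by rewrite of_polyX coordsE.
Qed.

Lemma of_poly_zpol : of_poly (zpol k p m e) = z.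
Proof.
rewrite zpol.unlock rmorph_zcoord /= of_poly_xpow !of_polyX !coordsE.
exact: (zcoord_ucoord pchar_polyC 'X xpow1_rel xiy_rel).
Qed.

Lemma of_poly_tpol : of_poly (tpol k p m e) = t.
Proof.
rewrite tpol.unlock rmorph_tcoord /= of_poly_xpow !of_polyX !coordsE.
exact: (tcoord_vcoord pchar_polyC 'X xpow1_rel xiy_rel).
Qed.

Lemma of_poly_ypol : of_poly (ypol k p m e) = y.
Proof.
apply: xpowCP_cancel; rewrite -of_poly_xpow -rmorphM -segre_zpol_tpol // rmorph_segre /=.
by rewrite of_poly_zpol of_poly_tpol of_poly_xpow xiy_rel.
Qed.

Lemma of_poly_wpol : of_poly (wpol k p m e) = 'X.
Proof.
apply: xpowCP_cancel; rewrite -of_poly_xpow -rmorphM -segre_wpol // rmorphB /=.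
rewrite rmorph_segre_g /= of_poly_zpol of_poly_tpol of_polyX coordsE of_poly_xpow.
by rewrite /SS addrK.
Qed.

Lemma of_poly_val c : of_poly (cval c) = c%:P.
Proof.
have [H ->] := im_subst_surj c; rewrite im_val_subst.
rewrite -[LHS]/((of_poly \o subst gens) H) -[RHS]/((polyC \o subst cg) H).
apply: mpoly_rmorph_ext => [a|i] /=; first by rewrite !substC alg_mpolyC of_polyC.
rewrite !substX; elim/ord3_ind: i => [||| j]; rewrite /gens coordsE.
- exact: of_poly_ypol.
- exact: of_poly_tpol.
- exact: of_poly_zpol.
- by rewrite of_polyX coordsE.
Qed.

Lemma to_polyK : cancel to_poly of_poly.
Proof.
elim/poly_ind => [|q c IH]; first by rewrite !rmorph0.
rewrite !rmorphD !rmorphM /= IH to_polyX of_poly_wpol to_polyC.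
by rewrite of_poly_val.
Qed.

Lemma of_polyK : cancel of_poly to_poly.
Proof.
have SE : to_poly SS = 'X_i2.
  rewrite /SS rmorphD rmorphM /= to_polyX to_polyC rmorph_segre_g /=.
  by rewrite !to_polyC cval_xpow -segre_wpol // cval_gen1 cval_gen2 subrK.
have cancel_xpow := mulfI (xpow_neq0 k p m e).
move=> q; rewrite -[LHS]/((to_poly \o of_poly) q) -[RHS]/(idfun q).
apply: mpoly_rmorph_ext => [a|i] /=.
  by rewrite of_polyC to_polyC rmorph_alg alg_mpolyC.
elim/ord3_ind: i => [||| j]; rewrite of_polyX coordsE.
- apply: cancel_xpow; have := congr1 to_poly (zcoord_ucoord pchar_polyC 'X xpow1_rel xiy_rel).
  rewrite rmorph_zcoord /= !to_polyC cval_gen2 zpol.unlock.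
  rewrite -/SS SE cval_xpow /zcoord => /addIr/addIr; exact.
- apply: cancel_xpow; have := congr1 to_poly (tcoord_vcoord pchar_polyC 'X xpow1_rel xiy_rel).
  rewrite rmorph_tcoord /= !to_polyC cval_gen1 tpol.unlock.
  rewrite -/SS SE cval_xpow /tcoord => /addIr; exact.
- exact: SE.
- by rewrite to_polyC cval_genx.
Qed.

Lemma stably_polynomial : is_stably_polynomial_ring m.+3 C.
Proof.
exists to_poly; split; first by exists of_poly; [exact: to_polyK|exact: of_polyK].
by move=> a q; rewrite rmorphM /= to_polyC rmorph_alg mulr_algl.
Qed.

End StableIsomorphism.

(** * Deformation invariants *)

(** Invariants of algebraic group actions of the additive group are of this
    kind.  The notion only refers to the ring structure, and so is preserved by
    ring isomorphisms that are not linear over the base field. *)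
Definition deformation_invariant (A : comNzRingType) (c : A) : Prop :=
  exists phi : {rmorphism A -> {poly A}},
    [/\ forall a, (phi a)`_0 = a, exists a, phi a <> a%:P & phi c = c%:P].

(** Restriction of a morphism to a subring of the target; it also yields
    inverses of bijective morphisms. *)
Lemma rmorph_lift (A B D : nzRingType) (T : {rmorphism A -> D})
    (iota : {rmorphism B -> D}) : injective iota ->
  (forall a, exists b, iota b = T a) ->
  exists phi : {rmorphism A -> B}, forall a, iota (phi a) = T a.
Proof.
move=> inj /choice[phi phiE].
have phiB : additive phi by move=> a b; apply: inj; rewrite phiE !rmorphB !phiE.
have phiM : multiplicative phi.
  by split=> [a b|]; apply: inj; rewrite phiE ?rmorphM ?rmorph1 ?phiE.
pose iA := GRing.isAdditive.Build A B phi phiB.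
pose iM := GRing.isMultiplicative.Build A B phi phiM.
pose phiR : {rmorphism A -> B} := HB.pack phi iA iM.
by exists phiR.
Qed.

Lemma rmorph_inverse (A B : nzRingType) (f : {rmorphism A -> B}) :
  bijective f -> exists g : {rmorphism B -> A}, cancel f g /\ cancel g f.
Proof.
move=> fbij; have [h _ fh] := fbij.
have [|g fg] := @rmorph_lift B A B idfun f (bij_inj fbij).
  by move=> b; exists (h b); rewrite fh.
by exists g; split=> // a; apply: (bij_inj fbij); rewrite fg.
Qed.

Lemma ring_isomorphic_sym (A B : comNzRingType) :
  ring_isomorphic A B -> ring_isomorphic B A.
Proof.
by case=> f fbij; have [g [fg gf]] := rmorph_inverse fbij; exists g, f.
Qed.

Lemma map_poly_inj0 (A B : nzRingType) (f : {rmorphism A -> B}) :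
  injective f -> injective (map_poly f).
Proof. by move=> inj; apply: map_inj_poly inj (rmorph0 f). Qed.

Lemma deformation_invariant_iso (A B : comNzRingType) (f : {rmorphism A -> B}) c :
  bijective f -> deformation_invariant c -> deformation_invariant (f c).
Proof.
move=> fbij [phi [phi0 [a phia] phic]].
have [g [fg gf]] := rmorph_inverse fbij.
exists (map_poly f \o (phi \o g)); split.
- by move=> b /=; rewrite coef_map /= phi0 gf.
- exists (f a) => /= ; rewrite fg -map_polyC => h; apply: phia.
  exact: map_poly_inj0 (bij_inj fbij) _ _ h.
- by rewrite /= fg phic map_polyC.
Qed.

Section Translation.
Variables (k : fieldType) (N : nat) (i : 'I_N).

Definition translation : {mpoly k[N]} -> {poly {mpoly k[N]}} :=
  mmap (polyC \o @mpolyC N k)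
    (fun l => if l == i then ('X_l)%:P + 'X else ('X_l)%:P).
HB.instance Definition _ := GRing.RMorphism.on translation.

Lemma translationC a : translation a%:MP = a%:MP%:P.
Proof. exact: mmapC. Qed.

Lemma translationX l :
  translation 'X_l = if l == i then ('X_l)%:P + 'X else ('X_l)%:P.
Proof. by rewrite /translation mmapX mmap1U. Qed.

Lemma translation_coef0 H : (translation H)`_0 = H.
Proof.
rewrite -horner_coef0 -[LHS]/((horner_eval 0 \o translation) H).
rewrite -[RHS]/(idfun H); apply: mpoly_rmorph_ext => [a|l] /=.
  by rewrite translationC /horner_eval hornerC.
rewrite translationX /horner_eval; case: ifP => _; rewrite ?hornerD hornerC //.
by rewrite hornerX addr0.
Qed.

End Translation.

Lemma mpoly_var_invariant (k : fieldType) (N : nat) (i : 'I_N) : (1 < N)%N ->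
  deformation_invariant ('X_i : {mpoly k[N]}).
Proof.
move=> N1; have [l li] : exists l : 'I_N, l != i.
  case: (eqVneq (i : nat) 0%N) => [i0|i0].
    by exists (Ordinal N1); rewrite -val_eqE /= i0.
  by exists (Ordinal (ltnW N1)); rewrite -val_eqE /= eq_sym.
exists (translation l); split.
- exact: translation_coef0.
- exists 'X_l; rewrite /= translationX eqxx => /(congr1 (fun q => q - ('X_l)%:P)).
  by rewrite addrC addKr subrr => /eqP; rewrite polyX_eq0.
- by rewrite /= translationX eq_sym (negbTE li).
Qed.

Section SurfaceInvariants.
Variables (k : fieldType) (p : nat) (m e : nat).
Hypotheses (pchark : p \in [pchar k]) (e_gt0 : (0 < e)%N).
Local Notation P := {mpoly k[m.+3]}.
Local Notation gens := (@gens k p m e).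
Local Notation C := (im_alg gens).
Local Notation cg := (im_gen gens).
Local Notation cval := (@im_val k m.+3 m.+3 gens).
Local Notation om := (@xorder p m e).
Local Notation xC := (xC k p m e).
Local Notation xpowC := (xpowC k p m e).
Local Notation xpow1C := (xpow1C k p m e).

Lemma deformation_of_translation i (q : 'I_m.+3 -> {poly C}) :
  (forall j, map_poly cval (q j) = translation i (gens j)) ->
  exists phi : {rmorphism C -> {poly C}},
    forall c, map_poly cval (phi c) = translation i (cval c).
Proof.
move=> qE; have inj := map_poly_inj0 (@im_val_inj _ _ _ gens).
apply: (@rmorph_lift C {poly C} _ (translation i \o cval) (map_poly cval)) => //.
move=> c; have [H ->] := im_subst_surj c.
pose f : {rmorphism P -> {poly C}} := mmap (polyC \o in_alg C) q.
have ext : map_poly cval \o f =1 translation i \o subst gens.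
  apply: mpoly_rmorph_ext => [a|j] /=.
    rewrite mmapC /= map_polyC /= substC rmorph_alg.
    by rewrite alg_mpolyC translationC.
  by rewrite mmapX mmap1U qE substX.
by exists (f H); rewrite /= im_val_subst; apply: ext.
Qed.

(** A translation of P that preserves the surface algebra and moves one of its
    elements makes all the elements it fixes deformation invariants. *)
Lemma translation_invariant i (q : 'I_m.+3 -> {poly C}) a c :
  (forall j, map_poly cval (q j) = translation i (gens j)) ->
  translation i (cval a) <> (cval a)%:P ->
  translation i (cval c) = (cval c)%:P -> deformation_invariant c.
Proof.
move=> /deformation_of_translation[phi phiE] nontriv inv.
have inj := map_poly_inj0 (@im_val_inj _ _ _ gens).
exists phi; split.
- move=> b; apply: im_val_inj.
  by rewrite -(coef_map cval) phiE translation_coef0.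
- exists a => h; apply: nontriv; rewrite -phiE h; exact: map_polyC.
- by apply: inj; rewrite phiE inv map_polyC.
Qed.

Lemma translation_xpow i : (forall j, i != ix j) ->
  translation i (xpow k p m e) = (xpow k p m e)%:P.
Proof.
move=> ix_i; rewrite xpow.unlock 2!polyC_exp [LHS]rmorphXn [X in X ^+ p]rmorphXn.
congr (_ ^+ _ ^+ _); rewrite /xprod 2!rmorph_prod; apply: eq_bigr => j _ /=.
by rewrite translationX eq_sym (negbTE (ix_i j)).
Qed.

Lemma translation_xpow1 i : (forall j, i != ix j) ->
  translation i (xpow1 k p m e) = (xpow1 k p m e)%:P.
Proof.
by move=> h; rewrite xpow1.unlock polyC_exp [LHS]rmorphXn /= translation_xpow.
Qed.

Lemma pchar_polyP : p \in [pchar {poly P}].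
Proof.
exact: (rmorph_pchar (polyC : {rmorphism P -> {poly P}}) (pchar_mpoly pchark _)).
Qed.

Lemma nonconstant_shift (a : P) : a%:P + (xpow k p m e)%:P * 'X <> a%:P.
Proof.
move/(congr1 (fun q : {poly P} => q`_1)); rewrite coefD coefMX [in RHS]coefC.
rewrite [X in X + _]coefC /= add0r coefC /= => /eqP.
by rewrite (negbTE (xpow_neq0 k p m e)).
Qed.

Lemma gens0 : gens i0 = ypol k p m e. Proof. exact: coords0. Qed.
Lemma gens1 : gens i1 = tpol k p m e. Proof. exact: coords1. Qed.
Lemma gens2 : gens i2 = zpol k p m e. Proof. exact: coords2. Qed.
Lemma gensx j : gens (ix j) = 'X_(ix j). Proof. exact: coordsx. Qed.
Definition gensE := (gens0, gens1, gens2, gensx).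

Section TranslationCoords.
Variables (i : 'I_m.+3) (U V S : {poly P}).
Hypotheses (iX : forall j, i != ix j) (TU : translation i 'X_i0 = U)
  (TV : translation i 'X_i1 = V) (TS : translation i 'X_i2 = S).

Lemma translation_ypol : translation i (ypol k p m e) =
  ycoord p (xpow k p m e)%:P (xpow1 k p m e)%:P U V S.
Proof.
rewrite -TU -TV -TS -(translation_xpow iX) -(translation_xpow1 iX) ypol.unlock.
exact: (rmorph_ycoord (translation i : {rmorphism P -> {poly P}})).
Qed.

Lemma translation_zpol : translation i (zpol k p m e) =
  zcoord p (xpow k p m e)%:P U S.
Proof.
rewrite -TU -TS -(translation_xpow iX) zpol.unlock.
exact: (rmorph_zcoord (translation i : {rmorphism P -> {poly P}})).
Qed.

Lemma translation_tpol : translation i (tpol k p m e) =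
  tcoord p (xpow k p m e)%:P V S.
Proof.
rewrite -TV -TS -(translation_xpow iX) tpol.unlock.
exact: (rmorph_tcoord (translation i : {rmorphism P -> {poly P}})).
Qed.

End TranslationCoords.

Let polyCR : {rmorphism P -> {poly P}} := polyC.

Lemma polyC_ypol : (ypol k p m e)%:P =
  ycoord p (xpow k p m e)%:P (xpow1 k p m e)%:P ('X_i0)%:P ('X_i1)%:P ('X_i2)%:P.
Proof. by rewrite ypol.unlock; exact: (rmorph_ycoord polyCR). Qed.

Lemma polyC_zpol : (zpol k p m e)%:P =
  zcoord p (xpow k p m e)%:P ('X_i0)%:P ('X_i2)%:P.
Proof. by rewrite zpol.unlock; exact: (rmorph_zcoord polyCR). Qed.

Lemma polyC_tpol : (tpol k p m e)%:P =
  tcoord p (xpow k p m e)%:P ('X_i1)%:P ('X_i2)%:P.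
Proof. by rewrite tpol.unlock; exact: (rmorph_tcoord polyCR). Qed.

Lemma translation_self (i : 'I_m.+3) :
  translation i ('X_i : P) = ('X_i)%:P + 'X.
Proof. by rewrite translationX eqxx. Qed.

Lemma translation_other (i l : 'I_m.+3) : l != i ->
  translation i ('X_l : P) = ('X_l)%:P.
Proof. by rewrite translationX => /negbTE ->. Qed.

Let Tu0 := translation_self i0.
Let Tu1 := translation_other (i := i0) (l := i1) isT.
Let Tu2 := translation_other (i := i0) (l := i2) isT.
Let Tv0 := translation_other (i := i1) (l := i0) isT.
Let Tv1 := translation_self i1.
Let Tv2 := translation_other (i := i1) (l := i2) isT.

Lemma u_translation_zpol : translation i0 (zpol k p m e) =
  (zpol k p m e)%:P + (xpow k p m e)%:P * 'X.
Proof.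
by rewrite (translation_zpol _ Tu0 Tu2) // zcoord_shift polyC_zpol.
Qed.

Lemma u_translation_tpol : translation i0 (tpol k p m e) = (tpol k p m e)%:P.
Proof. by rewrite (translation_tpol _ Tu1 Tu2) // polyC_tpol. Qed.

Lemma u_translation_ypol : translation i0 (ypol k p m e) =
  ushift p (xpow1 k p m e)%:P (ypol k p m e)%:P 'X.
Proof.
rewrite (translation_ypol _ Tu0 Tu1 Tu2) // (ycoord_shift_u pchar_polyP).
by rewrite polyC_ypol.
Qed.

Lemma v_translation_zpol : translation i1 (zpol k p m e) = (zpol k p m e)%:P.
Proof. by rewrite (translation_zpol _ Tv0 Tv2) // polyC_zpol. Qed.

Lemma v_translation_tpol : translation i1 (tpol k p m e) =
  (tpol k p m e)%:P + (xpow k p m e)%:P * 'X.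
Proof.
by rewrite (translation_tpol _ Tv1 Tv2) // tcoord_shift polyC_tpol.
Qed.

Lemma v_translation_ypol : translation i1 (ypol k p m e) =
  vshift p (xpow k p m e)%:P (xpow1 k p m e)%:P (tpol k p m e)%:P (ypol k p m e)%:P 'X.
Proof.
rewrite (translation_ypol _ Tv0 Tv1 Tv2) // (ycoord_shift_v pchar_polyP).
  by rewrite polyC_ypol polyC_tpol.
by rewrite -polyCM xpow_xpow1 // polyC_exp.
Qed.

Let cvalP : {rmorphism {poly C} -> {poly P}} := map_poly cval.

Let cvalPC c : cvalP c%:P = (cval c)%:P.
Proof. exact: map_polyC. Qed.

Let cvalPX : cvalP 'X = 'X.
Proof. exact: map_polyX. Qed.

Let shift_lin c d : cvalP (c%:P + d%:P * 'X) = (cval c)%:P + (cval d)%:P * 'X.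
Proof. by rewrite rmorphD rmorphM cvalPX !cvalPC. Qed.

(** The images of y, t, z, x_j under u |-> u + U and v |-> v + U lie in the
    surface algebra; the first translation fixes t and the second fixes z. *)
Definition u_action : 'I_m.+3 -> {poly C} :=
  coords (ushift p xpow1C%:P (cg i0)%:P 'X) (cg i1)%:P
    ((cg i2)%:P + xpowC%:P * 'X) (fun j => (cg (ix j))%:P).

Definition v_action : 'I_m.+3 -> {poly C} :=
  coords (vshift p xpowC%:P xpow1C%:P (cg i1)%:P (cg i0)%:P 'X)
    ((cg i1)%:P + xpowC%:P * 'X) (cg i2)%:P (fun j => (cg (ix j))%:P).

Lemma u_actionE j : map_poly cval (u_action j) = translation i0 (gens j).
Proof.
rewrite -/cvalP; elim/ord3_ind: j => [||| j]; rewrite /u_action coordsE ?gensE.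
- rewrite u_translation_ypol (rmorph_ushift cvalP) cvalPX !cvalPC.
  by rewrite cval_xpow1 cval_gen0.
- by rewrite u_translation_tpol cvalPC cval_gen1.
- by rewrite u_translation_zpol shift_lin cval_xpow cval_gen2.
- by rewrite cvalPC cval_genx translation_other.
Qed.

Lemma v_actionE j : map_poly cval (v_action j) = translation i1 (gens j).
Proof.
rewrite -/cvalP; elim/ord3_ind: j => [||| j]; rewrite /v_action coordsE ?gensE.
- rewrite v_translation_ypol (rmorph_vshift cvalP) cvalPX !cvalPC.
  by rewrite cval_xpow cval_xpow1 cval_gen0 cval_gen1.
- by rewrite v_translation_tpol shift_lin cval_xpow cval_gen1.
- by rewrite v_translation_zpol cvalPC cval_gen2.
- by rewrite cvalPC cval_genx translation_other.
Qed.

Lemma u_invariant c : translation i0 (cval c) = (cval c)%:P ->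
  deformation_invariant c.
Proof.
apply: (@translation_invariant i0 _ (cg i2) _ u_actionE).
by rewrite cval_gen2 u_translation_zpol; apply: nonconstant_shift.
Qed.

Lemma invariant_const a : deformation_invariant (a%:A : C).
Proof. by apply: u_invariant; rewrite rmorph_alg alg_mpolyC translationC. Qed.

Lemma invariant_x j : deformation_invariant (cg (ix j)).
Proof. by apply: u_invariant; rewrite cval_genx translation_other. Qed.

Lemma invariant_t : deformation_invariant (cg i1).
Proof. by apply: u_invariant; rewrite cval_gen1 u_translation_tpol. Qed.

Lemma invariant_z : deformation_invariant (cg i2).
Proof.
apply: (@translation_invariant i1 _ (cg i1) _ v_actionE).
  by rewrite cval_gen1 v_translation_tpol; apply: nonconstant_shift.
by rewrite cval_gen2 v_translation_zpol.
Qed.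

(** A nonzero scalar is a unit, and units of polynomial rings over a domain are
    constant; so a deformation fixes the base field automatically. *)
Lemma deformation_const (phi : {rmorphism C -> {poly C}}) a :
  (forall c, (phi c)`_0 = c) -> phi a%:A = (a%:A)%:P.
Proof.
move=> phi0; have [->|a0] := eqVneq a 0; first by rewrite scale0r rmorph0.
have inj := map_poly_inj0 (@im_val_inj _ _ _ gens).
have unit1 : cvalP (phi a%:A) * cvalP (phi (a^-1)%:A) = 1.
  by rewrite -!rmorphM -scalerAl mul1r scalerA divff // scale1r !rmorph1.
have /size1_polyC E : (size (cvalP (phi a%:A)) <= 1)%N.
  apply: (@size_factor _ _ (cvalP (phi (a^-1)%:A))); rewrite unit1 ?oner_eq0 //.
  by rewrite size_poly1.
by apply: inj; rewrite -/cvalP E cvalPC coef_map phi0.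
Qed.

(** Extended from the surface algebra to presentations, a deformation moves some
    generator and meets the hypotheses of [invariant_weight]. *)
Lemma invariant_nonneg c : deformation_invariant c ->
  forall i, wge (om i) 0%R (cval c).
Proof.
case=> phi [phi0 [b phib] phic] i.
have inj := map_poly_inj0 (@im_val_inj _ _ _ gens).
have [H cE] := im_subst_surj c; rewrite cE im_val_subst.
pose psi : {rmorphism P -> {poly P}} := cvalP \o (phi \o subst cg).
apply: (@invariant_weight k p m e pchark e_gt0 psi).
- move=> a; rewrite /psi /= substC deformation_const // cvalPC.
  by rewrite rmorph_alg alg_mpolyC.
- by move=> H'; rewrite /psi /= coef_map phi0 /= im_val_subst.
- move=> H1 H2 eqH; congr (cvalP (phi _)); apply: im_val_inj.
  by rewrite !im_val_subst.
- have [//|none] := pselect (exists j, psi 'X_j != (gens j)%:P).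
  have ext : psi =1 polyC \o subst gens.
    apply: mpoly_rmorph_ext => [a|j].
      rewrite /psi /= !substC deformation_const // cvalPC.
      by rewrite rmorph_alg.
    have [eqj|ne] := eqVneq (psi 'X_j) (gens j)%:P; last by case: none; exists j.
    by rewrite eqj; congr polyC; exact: (esym (substX _ _)).
  case: phib; have [H' bE] := im_subst_surj b; apply: inj.
  rewrite -/cvalP cvalPC bE im_val_subst; exact: ext.
- by rewrite /psi /= -cE phic cvalPC cE im_val_subst.
Qed.

End SurfaceInvariants.

(** * Elements without poles *)

Lemma mpoly_rmorph_closed (k : fieldType) (N : nat) (R : nzRingType)
    (Q : R -> Prop) (f : {rmorphism {mpoly k[N]} -> R}) :
  (forall a b, Q a -> Q b -> Q (a + b)) -> (forall a b, Q a -> Q b -> Q (a * b)) ->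
  (forall a, Q (f a%:MP)) -> (forall i, Q (f 'X_i)) -> forall q, Q (f q).
Proof.
move=> QD QM QC QX; elim/mpolyind => [|a mu q _ _ IH].
  by rewrite -(mpolyC0 N).
rewrite rmorphD -mul_mpolyC rmorphM; apply: (QD) => //; apply: (QM) => //.
rewrite mpolyXE_id rmorph_prod; elim/big_ind: _ => //.
  by rewrite -(rmorph1 f) -mpolyC1.
move=> i _; rewrite rmorphXn; elim: (mu i) => [|n IHn].
  by rewrite expr0 -(rmorph1 f) -mpolyC1.
by rewrite exprS; apply: QM.
Qed.

Section LowestWeights.
Variables (k : fieldType) (M : nat) (om : 'I_M -> int).
Implicit Types q : {mpoly k[M]}.

Lemma wge_low d d' q : wge om d q -> wcomp om d' q != 0 -> (d <= d')%R.
Proof.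
move=> h; rewrite leNgt; apply: contraNN => lt.
by rewrite (wcomp_gt lt h).
Qed.

Lemma wgeXn d q n : wge om d q -> wge om (d *+ n) (q ^+ n).
Proof.
move=> h; elim: n => [|n IH]; first exact/whom_wge/whomC.
by rewrite exprS mulrS; apply: wgeM.
Qed.

Lemma wcompXn d q n : wge om d q ->
  wcomp om (d *+ n) (q ^+ n) = wcomp om d q ^+ n.
Proof.
move=> h; elim: n => [|n IH]; first by rewrite mulr0n !expr0 wcomp_id ?whomC.
by rewrite !exprS mulrS wcompM // ?IH //; apply: wgeXn.
Qed.

Lemma whom_low d d' q : whom om d q -> wcomp om d' q != 0 -> d' = d.
Proof.
move=> /whomP h; have [//|ne] := eqVneq d' d; case/eqP.
apply/mpolyP => mu; rewrite mcoeff_wcomp mcoeff0; case: ifP => // /eqP muE.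
rewrite memN_msupp_eq0 //; apply/negP => /h; rewrite muE => E.
by rewrite E eqxx in ne.
Qed.

End LowestWeights.

Section ClearDenominators.
Variables (k : fieldType) (p m : nat) (A : comAlgType k) (h : 'I_m.+3 -> A).
Variable r : nat.
Let X := \prod_j h (ix j).
Hypothesis rel : X ^+ r * h i0 = segre p (h i2) (h i1).

(** Since x^r y = f(z, t), each occurrence of y in a monomial can be traded
    against a factor x^r. *)
Lemma clear_denominators a b (H : {mpoly k[m.+3]}) :
  (forall mu, mu \in msupp H ->
     forall j, (r * mu i0 + b <= mu (ix j) + a)%N) ->
  exists H', X ^+ a * subst h H = X ^+ b * subst (base_coords h) H'.
Proof.
move=> hH; rewrite [H]mpolyE raddf_sum /= mulr_sumr.
rewrite big_seq; elim/big_ind: _ => [|c c' [H1 ->] [H2 ->]|mu /hH{}hH].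
- by exists 0; rewrite rmorph0 mulr0.
- by exists (H1 + H2); rewrite rmorphD mulrDr.
exists (H@_mu *: ((\prod_j 'X_(ix j) ^+ (mu (ix j) + a - (r * mu i0 + b)))
  * (segre p 'X_i2 'X_i1 ^+ mu i0 * 'X_i1 ^+ mu i1 * 'X_i2 ^+ mu i2))).
rewrite !linearZ /= -!scalerAr; congr (_ *: _).
have muE : subst h 'X_[mu] =
    h i0 ^+ mu i0 * h i1 ^+ mu i1 * h i2 ^+ mu i2 * \prod_j h (ix j) ^+ mu (ix j).
  rewrite mpolyXE_id rmorph_prod /= (@big_split_ord _ _ _ 3 m) /=.
  under eq_bigr => l _ do rewrite rmorphXn /= substX.
  under [X in _ * X]eq_bigr => l _ do rewrite rmorphXn /= substX.
  rewrite !big_ord_recl big_ord0 mulr1 !mulrA.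
  by congr (h _ ^+ mu _ * h _ ^+ mu _ * h _ ^+ mu _ * _); apply: val_inj.
rewrite muE !rmorphM !rmorphXn rmorph_segre /= !substX /base_coords !coordsE -rel.
rewrite rmorph_prod /=.
under [in RHS]eq_bigr => j _ do rewrite rmorphXn /= substX coordsE.
set Y := \prod_j h (ix j) ^+ (_ - _); set W := \prod_j h (ix j) ^+ _.
have key : X ^+ a * W = Y * (X ^+ b * X ^+ (r * mu i0)).
  rewrite -exprD /X -!prodrXl -!big_split; apply: eq_bigr => j _ /=.
  by rewrite -!exprD; congr (_ ^+ _); have := hH j; lia.
rewrite exprMn -exprM.
transitivity (X ^+ a * W * (h i0 ^+ mu i0 * h i1 ^+ mu i1 * h i2 ^+ mu i2)).
  by ring.
by rewrite key; ring.
Qed.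

Lemma clear_poles (H : {mpoly k[m.+3]}) :
  exists M H', X ^+ M * subst h H = subst (base_coords h) H'.
Proof.
exists (\max_(mu <- msupp H) (r * mu i0))%N.
have [|H' HE] := @clear_denominators (\max_(mu <- msupp H) (r * mu i0))%N 0 H.
  move=> mu muS l; rewrite addn0; apply: leq_trans (leq_addl _ _).
  by apply: (leq_bigmax_seq (F := fun mu : 'X_{1..m.+3} => (r * mu i0)%N)).
by exists H'; rewrite HE expr0 mul1r.
Qed.

Lemma factor_out (H : {mpoly k[m.+3]}) :
  (forall mu, mu \in msupp H -> forall j, (r * mu i0 < mu (ix j))%N) ->
  exists H', subst h H = X * subst (base_coords h) H'.
Proof.
move=> hH; have [|H' HE] := @clear_denominators 0 1 H.
  by move=> mu /hH lt j; rewrite addn1 addn0.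
by exists H'; move: HE; rewrite expr0 mul1r expr1.
Qed.

End ClearDenominators.

(** * The surface algebra is not a polynomial ring *)

Section Cancellation.
Variables (k : fieldType) (p : nat) (m e : nat).
Hypotheses (pchark : p \in [pchar k]) (e_gt0 : (0 < e)%N).
Local Notation gens := (@gens k p m e).
Local Notation C := (im_alg gens).
Local Notation cg := (im_gen gens).
Local Notation cval := (@im_val k m.+3 m.+3 gens).
Local Notation om := (@xorder p m e).
Local Notation omQ := (@xorderQ p m e).
Local Notation Dv := (mderiv (@i1 m)).

Let p_gt0 : (0 < p)%N.
Proof. exact: prime_gt0 (pcharf_prime pchark). Qed.

Lemma ypol_neq0 : ypol k p m e != 0.
Proof.
apply/eqP => y0; have := mderiv_ypol m e pchark; rewrite y0 mderiv0 => /esym/eqP.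
by rewrite oppr_eq0 oner_eq0.
Qed.

Lemma whom_ypol i : whom (om i) (- (e * p)%:Z) (ypol k p m e).
Proof. by have := whom_gens e pchark i i0; rewrite gens0 /xorderQ coordsE. Qed.

Lemma ypol_not_nonneg i : ~~ wge (om i) 0%R (ypol k p m e).
Proof.
apply/negP => h; have := wge_low h (d' := - (e * p)%:Z).
rewrite wcomp_id ?whom_ypol // ypol_neq0 => /(_ isT).
by rewrite oppr_ge0 => le; have : (0 < e * p)%N by [rewrite muln_gt0 e_gt0]; lia.
Qed.

(** Every variable of a polynomial ring in at least two variables is fixed by
    the translation of another one. *)
Lemma not_polynomial n (i : 'I_m) : (1 < n)%N -> ~ is_polynomial_ring n C.
Proof.
move=> n1 [f fbij]; have [g [fg gf]] := rmorph_inverse fbij.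
have nonneg q : wge (om i) 0%R (cval (g q)).
  have := @mpoly_rmorph_closed k n _ (wge (om i) 0%R) (cval \o g); apply.
  - exact: wgeD.
  - by move=> a b ha hb; rewrite -[0%R]addr0; apply: wgeM.
  - move=> a /=; have -> : g a%:MP = a%:A.
      by apply: (bij_inj fbij); rewrite gf linearZ /= rmorph1 alg_mpolyC.
    by rewrite rmorph_alg alg_mpolyC; apply/whom_wge/whomC.
  - move=> l; apply: invariant_nonneg => //.
    by apply: deformation_invariant_iso; [exists f | apply: mpoly_var_invariant].
have := nonneg (f (cg i0)); rewrite fg cval_gen0.
by apply/negP; apply: ypol_not_nonneg.
Qed.

Lemma mwt_omQ i mu :
  mwt (omQ i) mu = (mu (ix i))%:Z - (e * p * mu i0)%:Z.
Proof.
have nat_int (a : int) n : a *+ n = a * n%:Z by rewrite -mulr_natr natz.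
rewrite /mwt (@big_split_ord _ _ _ 3 m) /= 3!big_ord_recl big_ord0.
have E0 : lshift m (ord0 : 'I_3) = i0 by apply: val_inj.
have E1 : lshift m (lift ord0 ord0 : 'I_3) = i1 by apply: val_inj.
have E2 : lshift m (lift ord0 (lift ord0 ord0) : 'I_3) = i2 by apply: val_inj.
rewrite E0 E1 E2 /xorderQ !coordsE !mul0rn !addr0 (bigD1 i) //= big1 => [|j ji].
  have -> : rshift 3 i = ix i by [].
  rewrite coordsE eqxx addr0 (nat_int _ (mu i0)) (nat_int _ (mu (ix i))).
  by rewrite mulNr mul1r -PoszM addrC.
have -> : rshift 3 j = ix j by [].
by rewrite coordsE (negbTE ji) mul0rn.
Qed.

(** A pole of order less than ep is too small for a monomial containing y, unless
    the monomial is a multiple of x_i; so modulo x_i only the part in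
    k[x_1, ..., x_m, z, t] remains. *)
Lemma kill_low_weight i d c : (- (e * p)%:Z < d)%R -> wge (om i) d (cval c) ->
  Dv (kill (pred1 (ix i)) (cval c)) = 0.
Proof.
move=> d_gt hc; have [H0 cE] := im_subst_surj c.
have gh (l : 'I_1) j := whom_gens e pchark i j.
have [H HE Hw] := minimal_representation gh H0.
rewrite cE im_val_subst -HE in hc *.
have {Hw} := Hw ord0 d; rewrite -HE => /(_ hc) /wgeP Hd.
rewrite [H]mpolyE (raddf_sum (subst gens)) (raddf_sum (kill _)).
rewrite (raddf_sum (mderiv i1)) /=; apply: big1_seq => mu /andP[_ /Hd].
rewrite mwt_omQ => mud.
rewrite [subst gens _]linearZ [kill _ _]linearZ mderivZ /=.
have [mu0|mu_gt0] := posnP (mu i0); last first.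
  have mui : (0 < mu (ix i))%N by nia.
  rewrite mpolyXE_id (rmorph_prod (subst gens)) (rmorph_prod (kill _)) /=.
  rewrite (bigD1 (ix i)) //= (rmorphXn (subst gens)) (rmorphXn (kill _)) /= substX.
  rewrite gensx killX /= eqxx expr0n eqn0Ngt mui mul0r mderiv0.
  by rewrite scaler0.
rewrite mpolyXE_id (rmorph_prod (subst gens)) (rmorph_prod (kill _)) /=.
suff -> : Dv (\prod_l kill (pred1 (ix i)) (subst gens ('X_l ^+ mu l))) = 0.
  by rewrite scaler0.
elim/big_ind: _ => [|a b|l _].
- by rewrite -mpolyC1 mderivC.
- exact: mderiv_mul0.
rewrite (rmorphXn (subst gens)) (rmorphXn (kill _)) /= substX.
have [->|l0] := eqVneq l i0.
  by rewrite mu0 expr0 -mpolyC1 mderivC.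
have -> : gens l = base_coords gens l.
  by elim/ord3_ind: l l0 => [||| j] //; rewrite /base_coords /gens !coordsE.
by apply: mderiv_exp0; apply: mderiv_kill_base => //=; rewrite eqxx.
Qed.

End Cancellation.

(** * Different exponents give non-isomorphic rings *)

Lemma rmorphXnM (A B : nzRingType) (f : {rmorphism A -> B}) a b n :
  f (a ^+ n * b) = f a ^+ n * f b.
Proof. by rewrite rmorphM rmorphXn. Qed.

Section NonIsomorphism.
Variables (k : fieldType) (p : nat) (m e e' : nat).
Hypotheses (pchark : p \in [pchar k]) (e_gt0 : (0 < e)%N) (lt_e : (e < e')%N).
Local Notation P := {mpoly k[m.+3]}.
Local Notation C := (im_alg (@gens k p m e)).
Local Notation C' := (im_alg (@gens k p m e')).
Local Notation cg := (im_gen (@gens k p m e)).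
Local Notation cg' := (im_gen (@gens k p m e')).
Local Notation cval := (@im_val k m.+3 m.+3 (@gens k p m e)).
Local Notation cval' := (@im_val k m.+3 m.+3 (@gens k p m e')).
Local Notation xC' := (xC k p m e').
Local Notation xC := (xC k p m e).
Local Notation Dv := (mderiv (@i1 m)).

(** The generators of the base ring are deformation invariants, and these are
    preserved by isomorphisms. *)
Lemma base_nonneg (d d' : nat) (d_gt0 : (0 < d)%N) (d'_gt0 : (0 < d')%N)
    (s : {rmorphism im_alg (@gens k p m d) -> im_alg (@gens k p m d')}) H i :
  bijective s -> wge (xorder p d' i) 0%R
    (im_val (s (subst (base_coords (im_gen (@gens k p m d))) H))).
Proof.
move=> sbij; set g := im_gen _.
have nonneg c : deformation_invariant c -> wge (xorder p d' i) 0%R (im_val (s c)).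
  by move=> h; apply: invariant_nonneg => //; apply: deformation_invariant_iso.
pose f : {rmorphism P -> P} := @im_val _ _ _ (@gens k p m d') \o
  (s \o subst (base_coords g)).
apply: (@mpoly_rmorph_closed k m.+3 _ (wge (xorder p d' i) 0%R) f).
- exact: wgeD.
- by move=> a b ha hb; rewrite -[0%R]addr0; apply: wgeM.
- by move=> a; rewrite /f /= substC; apply/nonneg/invariant_const.
- move=> l; rewrite /f /= substX /base_coords.
  elim/ord3_ind: l => [||| j]; rewrite coordsE.
  + by rewrite !rmorph0; apply: wge0.
  + exact/nonneg/invariant_t.
  + exact/nonneg/invariant_z.
  + exact/nonneg/invariant_x.
Qed.

Lemma im_val_morph_neq0 d d'
    (s : {rmorphism im_alg (@gens k p m d) -> im_alg (@gens k p m d')}) c :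
  injective s -> im_val c != 0 -> im_val (s c) != 0.
Proof.
move=> sinj; apply: contraNneq => sc0.
have /sinj -> : s c = s 0 by apply: im_val_inj; rewrite sc0 !rmorph0.
by rewrite rmorph0.
Qed.

Lemma xC_rel d (d_gt0 : (0 < d)%N) :
  let g := im_gen (@gens k p m d) in
  (\prod_j g (ix j)) ^+ (d * p) * g i0 = segre p (g i2) (g i1).
Proof.
move=> g; rewrite -xpowC_yC //; congr (_ * _).
by rewrite xpowC.unlock xCE exprM.
Qed.

Lemma non_isomorphic (i : 'I_m) : ~ ring_isomorphic C C'.
Proof.
case=> s sbij; have [t [st ts]] := rmorph_inverse sbij.
have tbij : bijective t := Bijective ts st.
have e'_gt0 : (0 < e')%N by apply: leq_ltn_trans lt_e.
have p_gt0 : (0 < p)%N := prime_gt0 (pcharf_prime pchark).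
have base := base_nonneg e_gt0 e'_gt0 (s := s) _ i sbij.
have base' j := base_nonneg e'_gt0 e_gt0 (s := t) _ j tbij.
pose beta := t xC'.
have betaN0 : cval beta != 0.
  by apply: im_val_morph_neq0 (bij_inj tbij) _; rewrite cval_x xprod_neq0.
(* For large M the element x'^M s(y) is in the base ring of the target, so
   beta^M y has no pole, although y has one along every x_j. *)
have beta_pos j : wge (xorder p e j) 1%R (cval beta).
  have [H cE] := im_subst_surj (s (cg i0)).
  have [M [H' HE]] := clear_poles (xC_rel e'_gt0) H.
  have tE : cval (t (subst (base_coords cg') H')) = cval beta ^+ M * ypol k p m e.
    rewrite -HE -cE -xCE.
    transitivity (cval (beta ^+ M * t (s (cg i0)))).
      by congr cval; exact: (rmorphXnM t xC' (s (cg i0)) M).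
    transitivity (cval (beta ^+ M * cg i0)); first by congr (cval (_ * _)); exact: st.
    by rewrite -cval_gen0; exact: (rmorphXnM cval beta (cg i0) M).
  have := base' H' j; rewrite tE => nonneg.
  have [d [hd dN0]] := wlow_exists (xorder p e j) betaN0.
  apply: (wgeW _ hd); rewrite leNgt; apply/negP => d_lt1.
  have yE : wcomp (xorder p e j) (- (e * p)%:Z) (ypol k p m e) = ypol k p m e.
    by rewrite wcomp_id ?whom_ypol.
  have yge : wge (xorder p e j) (- (e * p)%:Z) (ypol k p m e).
    by rewrite whom_wge ?whom_ypol.
  have lowE : wcomp (xorder p e j) (d *+ M + - (e * p)%:Z) (cval beta ^+ M * ypol k p m e)
      = wcomp (xorder p e j) d (cval beta) ^+ M * ypol k p m e.
    by rewrite (wcompM (wgeXn M hd) yge) (wcompXn M hd) yE.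
  have := wge_low nonneg (d' := d *+ M + - (e * p)%:Z).
  rewrite lowE mulf_neq0 ?expf_neq0 ?ypol_neq0 // => /(_ isT).
  have : (0 < e * p)%N by rewrite muln_gt0 e_gt0.
  have : (d <= 0)%R by lia.
  by move=> dle0; have : (d *+ M <= 0)%R := mulrn_wle0 M dle0; lia.
(* All the monomials of a minimal presentation of beta have positive order
   along every x_j. *)
have [b betaE] : exists H', beta = xC * subst (base_coords cg) H'.
  have [H0 bE] := im_subst_surj beta.
  have [H HE Hw] := minimal_representation (@whom_gens k p m e pchark) H0.
  have bE' : beta = subst cg H.
    by rewrite bE; apply: im_val_inj; rewrite !im_val_subst HE.
  have [|H' H'E] := factor_out (xC_rel e_gt0) (H := H).
    move=> mu muS j; have := Hw j 1%R.
    rewrite -im_val_subst -bE => /(_ (beta_pos j))/wgeP/(_ _ muS).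
    by rewrite mwt_omQ; lia.
  by exists H'; rewrite [xC]xCE; exact: (etrans bE' H'E).
have xE : xprod k m = cval' (s xC) * cval' (s (subst (base_coords cg) b)).
  rewrite -(cval_x k p m e') -(ts xC') -/beta betaE.
  transitivity (cval' (s xC * s (subst (base_coords cg) b))).
    by congr cval'; exact: (rmorphM s).
  exact: (rmorphM cval').
have /andP[x1N0 x2N0] : (cval' (s xC) != 0) && (cval' (s (subst (base_coords cg) b)) != 0).
  by rewrite -negb_or -mulf_eq0 -xE xprod_neq0.
have [d1 [hd1 d1N0]] := wlow_exists (xorder p e' i) x1N0.
have [d2 [hd2 d2N0]] := wlow_exists (xorder p e' i) x2N0.
have d2_ge0 : (0 <= d2)%R := wge_low (base b) d2N0.
(* The product x' = s(x) s(b) has order 1, and s(b) has no pole. *)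
have d1_le1 : (d1 <= 1)%R.
  have := whom_low (whom_xprod k p e' i) (d' := d1 + d2).
  rewrite xE wcompM // mulf_neq0 // => /(_ isT); lia.
(* The image of f(z, t) = x^(ep) y has no pole. *)
have y_order : wge (xorder p e' i) (- (e * p)%:Z) (cval' (s (cg i0))).
  have yN0 : cval' (s (cg i0)) != 0.
    by apply: im_val_morph_neq0 (bij_inj sbij) _; rewrite cval_gen0 ypol_neq0.
  have [d3 [hd3 d3N0]] := wlow_exists (xorder p e' i) yN0.
  have := base (segre p 'X_i2 'X_i1).
  rewrite rmorph_segre /= !substX /base_coords !coordsE -xC_rel // -xCE.
  rewrite (rmorphXnM s xC (cg i0) (e * p)).
  rewrite (rmorphXnM cval' (s xC) (s (cg i0)) (e * p)) /= => nonneg.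
  have := wge_low nonneg (d' := d1 *+ (e * p) + d3).
  rewrite (wcompM (wgeXn (e * p) hd1) hd3) (wcompXn (e * p) hd1).
  rewrite mulf_neq0 ?expf_neq0 // => /(_ isT).
  have : (d1 *+ (e * p) <= (e * p)%:Z)%R.
    by rewrite -(natz (e * p)); apply: ler_wMn2r.
  move=> d1e d3_ge; apply: (wgeW _ hd3).
  apply: (@le_trans _ _ (- (d1 *+ (e * p)))); first by rewrite lerN2.
  by rewrite -subr_ge0 opprK addrC.
pose f : {rmorphism P -> P} := cval' \o (s \o subst cg).
(* Modulo x_i every element of the image of s, that is of the whole target,
   has derivative 0 with respect to v; but y becomes -v. *)
have Dv0 : forall q, Dv (kill (pred1 (ix i)) (f q)) = 0.
  have lowP d c : (- (e' * p)%:Z < d)%R -> wge (xorder p e' i) d (cval' c) ->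
      Dv (kill (pred1 (ix i)) (cval' c)) = 0 by apply: kill_low_weight.
  have e'p : (- (e' * p)%:Z < 0)%R.
    by rewrite oppr_lt0 ltz_nat muln_gt0 e'_gt0.
  have nonneg c : deformation_invariant c -> Dv (kill (pred1 (ix i)) (cval' (s c))) = 0.
    move=> h; apply: lowP e'p _; apply: invariant_nonneg => //.
    exact: deformation_invariant_iso.
  have closed := @mpoly_rmorph_closed k m.+3 _
    (fun q => Dv (kill (pred1 (ix i)) q) = 0) f.
  apply: closed.
  - by move=> a c ha hc; rewrite rmorphD mderivD ha hc addr0.
  - by move=> a c ha hc; rewrite rmorphM; apply: mderiv_mul0.
  - by move=> a; rewrite /f /= substC; apply/nonneg/invariant_const.
  - move=> l; rewrite /f /= substX; elim/ord3_ind: l => [||| j].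
    + by apply: lowP y_order; rewrite ltrN2 ltz_nat ltn_pmul2r.
    + exact/nonneg/invariant_t.
    + exact/nonneg/invariant_z.
    + exact/nonneg/invariant_x.
have [H tE] := im_subst_surj (t (cg' i0)).
have fE : f H = ypol k p m e' by rewrite -cval_gen0 -(ts (cg' i0)) tE.
have := Dv0 H; rewrite fE (@kill_ypol _ _ _ _ pchark e'_gt0 _ i) //=.
rewrite killX /= mderivN mderivX mnm1E eqxx.
rewrite -{1}[U_(_)%MM]add0m addmK mpolyX0 scale1r => /eqP.
by rewrite oppr_eq0 oner_eq0.
Qed.

End NonIsomorphism.

(** * Krull dimension *)

Section AlgebraicDependence.
Variables (k : fieldType) (N : nat) (c : 'I_N.+1 -> {mpoly k[N]}).

Let mone : 'I_N -> int := fun=> -1.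

Let mwt_mone m i : (mwt mone m <= - (m i)%:Z)%R.
Proof.
rewrite /mwt (bigD1 i) //= /mone mulNrn natz gerDl.
by apply: sumr_le0 => j _; rewrite mulrn_wle0.
Qed.

Let degree_bound : exists d : nat, forall j, wge mone (- d%:Z) (c j).
Proof.
have /choice[d hd] j : exists d : nat, wge mone (- d%:Z) (c j).
  have [->|cN0] := eqVneq (c j) 0.
    by exists 0%N; apply: wge0.
  have [d [hd _]] := wlow_exists mone cN0; exists `|d|%N.
  by apply: wgeW hd; lia.
exists (\sum_j d j)%N => j; apply: wgeW (hd j).
by rewrite lerN2 lez_nat (bigD1 j) //= leq_addr.
Qed.

(** Counting: the number of monomials of partial degrees at most D in N + 1
    variables grows like D^(N+1), the dimension of the space containing their
    values like D^N. *)
Lemma algebraically_dependent :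
  exists2 R : {mpoly k[N.+1]}, R != 0 & subst c R = 0.
Proof.
have [d hd] := degree_bound.
(* Chosen so that B^N = q^N (D+1)^N < (D+1)^(N+1), while N + 1 factors of
   degree at most d, each with exponent at most D, have degree less than B. *)
pose q := (d * N.+1).+1; pose D := (q ^ N)%N; pose B := (q * D.+1)%N.
pose T1 := {ffun 'I_N.+1 -> 'I_D.+1}; pose T2 := {ffun 'I_N -> 'I_B}.
have cards : (#|T2| < #|T1|)%N.
  rewrite !card_ffun !card_ord expnMn expnS ltn_pmul2r ?expn_gt0 //.
pose mon (f : T1) : 'X_{1..N.+1} := [multinom (f i : nat) | i < N.+1].
pose mon2 (f : T2) : 'X_{1..N} := [multinom (f i : nat) | i < N].
pose A : 'M[k]_(#|T1|, #|T2|) :=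
  \matrix_(i, j) (subst c 'X_[mon (enum_val i)])@_(mon2 (enum_val j)).
have kerN0 : kermx A != 0.
  rewrite -mxrank_eq0 mxrank_ker subn_eq0 -ltnNge.
  exact: leq_ltn_trans (rank_leq_col A) cards.
have /rowV0Pn[v /sub_kermxP vA vN0] := kerN0.
have mon_inj : injective mon.
  move=> f g /mnmP fg; apply/ffunP => i; apply: val_inj.
  by have := fg i; rewrite !mnmE.
pose R := \sum_i v 0 i *: 'X_[mon (enum_val i)] : {mpoly k[N.+1]}.
exists R.
  have [i vi] : exists i, v 0 i != 0.
    have [//|none] := pselect (exists i, v 0 i != 0); case/eqP: vN0.
    apply/rowP => i; rewrite mxE; apply/eqP; rewrite -[_ == _]negbK.
    by apply/negP => vi; apply: none; exists i.
  apply: contraNneq vi => R0.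
  have := congr1 (mcoeff (mon (enum_val i))) R0.
  rewrite mcoeff0 /R raddf_sum /= (bigD1 i) //= mcoeffZ mcoeffX eqxx mulr1.
  rewrite big1 ?addr0 => [->//|j ji]; rewrite mcoeffZ mcoeffX.
  by rewrite (inj_eq mon_inj) (inj_eq enum_val_inj) (negbTE ji) mulr0.
have Rdeg : wge mone (- (d * N.+1 * D)%N%:Z) (subst c R).
  rewrite /R raddf_sum /=; apply: wge_sum => i _; rewrite linearZ /=.
  apply: wgeZ; rewrite mpolyXE_id rmorph_prod /=.
  have le : (- (d * N.+1 * D)%N%:Z <=
      \sum_(l < N.+1) (- d%:Z) *+ (mon (enum_val i) l))%R.
    apply: le_trans (ler_sum (F := fun=> - (d * D)%N%:Z) _ _); last first.
      move=> l _; rewrite -mulr_natr natz mulNr -PoszM lerN2 lez_nat leq_mul2l.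
      by rewrite mnmE -ltnS ltn_ord orbT.
    rewrite sumr_const card_ord -mulr_natr natz mulNr -PoszM.
    by rewrite mulnAC.
  apply: wgeW le _.
  elim/big_ind2: _ => [|a1 b1 a2 b2|l _]; first exact/whom_wge/whomC.
    exact: wgeM.
  by rewrite rmorphXn /= substX; apply: wgeXn.
apply/mpolyP => mu; rewrite mcoeff0; apply/eqP; rewrite -[_ == _]negbK.
rewrite -mcoeff_msupp; apply/negP => muS.
have muB i : (mu i < B)%N.
  have := le_trans (wgeP _ _ _ Rdeg _ muS) (mwt_mone mu i).
  rewrite lerN2 lez_nat => le; apply: leq_ltn_trans le _.
  have aux (w E : nat) : (w * E < w.+1 * E.+1)%N by nia.
  exact: aux.
pose f : T2 := [ffun i => Ordinal (muB i)].
have muE : mu = mon2 f by apply/mnmP => i; rewrite !mnmE ffunE.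
have := congr1 (fun w : 'rV_ _ => w 0 (enum_rank f)) vA; rewrite !mxE => vAf.
move: muS; rewrite mcoeff_msupp muE /R => /negP[]; apply/eqP.
rewrite (raddf_sum (subst c)) (raddf_sum (mcoeff _)) /= -[RHS]vAf; apply: eq_bigr => i _.
by rewrite mxE enum_rankK [subst c _]linearZ /= mcoeffZ.
Qed.

End AlgebraicDependence.

Lemma eq_subst (k : fieldType) (N : nat) (A : comAlgType k) (h h' : 'I_N -> A) :
  h =1 h' -> subst h =1 subst h'.
Proof.
by move=> hh'; apply: mpoly_rmorph_ext => [a|i]; rewrite /= ?substC ?substX.
Qed.

Section Peel.
Variables (k : fieldType) (N : nat).

Definition peel : {mpoly k[N.+1]} -> {poly {mpoly k[N]}} :=
  mmap (polyC \o @mpolyC N k)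
    (fun i => if unlift ord_max i is Some j then ('X_j)%:P else 'X).
HB.instance Definition _ := GRing.RMorphism.on peel.

Lemma horner_peel (A : comAlgType k) (h : 'I_N.+1 -> A) R :
  subst h R = (map_poly (subst (h \o lift ord_max)) (peel R)).[h ord_max].
Proof.
have comm : commr_rmorph (subst (h \o lift ord_max)) (h ord_max).
  by move=> q; apply: mulrC.
rewrite -[RHS]/((horner_morph comm \o peel) R).
apply: mpoly_rmorph_ext => [a|i] /=.
  by rewrite /peel mmapC /= horner_morphC /= !substC.
rewrite /peel mmapX mmap1U substX; case: unliftP => [j ->|->].
  by rewrite horner_morphC /= substX.
by rewrite horner_morphX.
Qed.

Lemma peel_eq0 R : peel R = 0 -> R = 0.
Proof.
move=> R0; have := @horner_peel {mpoly k[N.+1]} (fun i => 'X_i) R.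
rewrite R0 rmorph0 horner0 => <-; rewrite -[LHS]/(idfun R).
by apply: mpoly_rmorph_ext => [a|i]; rewrite /= ?substC ?substX ?alg_mpolyC.
Qed.

End Peel.

(** Chain elements are algebraically independent, by the argument of Coquand
    and Lombardi.  The lowest element plays the role of the outermost variable:
    if q(c_0) lies in Q_0, its constant coefficient lies in Q_1, since c_0 does,
    and so vanishes by induction; then c_0, which is not in Q_0, can be divided
    out. *)
Lemma chain_independent (k : fieldType) (A : comAlgType k) (N : nat)
    (Q : nat -> {pred A}) (c : nat -> A) :
  (forall i, (i <= N)%N -> prime_ideal_pred (Q i)) ->
  (forall i, (i < N)%N -> {subset Q i <= Q i.+1}) ->
  (forall i, (i < N)%N -> c i \in Q i.+1 /\ c i \notin Q i) ->
  forall R : {mpoly k[N]}, subst (fun j : 'I_N => c (N - j.+1)%N) R \in Q 0 ->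
  R = 0.
Proof.
elim: N Q c => [|N IH] Q c prQ subQ cQ R.
  have -> : R = (R@_0%MM)%:MP.
    apply/mpolyP => m; rewrite mcoeffC.
    have -> : m = 0%MM by apply/mnmP => -[].
    by rewrite eqxx mulr1.
  rewrite substC; set a := R@_0%MM; have [-> //|a0] := eqVneq a 0.
  have [[Q0 Q1 Qlin] _] := prQ 0 (leqnn 0).
  have := Qlin (a^-1)%:A a%:A 0 => /[swap] aQ /(_ aQ Q0).
  by rewrite addr0 -scalerAl mul1r scalerA mulVf // scale1r (negbTE Q1).
have [[Q00 _ Q0lin] Q0prime] := prQ 0 isT.
have [[Q10 _ Q1lin] _] := prQ 1 isT.
have [c0Q1 c0Q0] := cQ 0 isT.
set h := fun j : 'I_N => c ((N - j.+1).+1)%N.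
have IHR r : subst h r \in Q 1%N -> r = 0.
  refine (IH (fun i => Q i.+1) (fun i => c i.+1) _ _ _ r) => i lt.
  - exact: prQ.
  - exact: subQ.
  - exact: cQ.
suff key (q : {poly {mpoly k[N]}}) : (map_poly (subst h) q).[c 0%N] \in Q 0 -> q = 0.
  move=> RQ; apply/peel_eq0/key; move: RQ; rewrite horner_peel /= subnn.
  rewrite (eq_map_poly (g := subst h)) // => r; apply: eq_subst => j /=.
  by rewrite /bump leqNgt ltn_ord add0n subSS /h subnSK.
elim/poly_ind: q => // q r IHq.
rewrite rmorphD rmorphM /= map_polyX map_polyC hornerD hornerMX hornerC /= => inQ.
have r0 : r = 0.
  apply: IHR; have := Q1lin (- (map_poly (subst h) q).[c 0%N]) _ _ c0Q1 (subQ 0%N isT _ inQ).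
  by rewrite mulNr addKr.
move: inQ; rewrite r0 rmorph0 addr0 => /Q0prime/orP[/IHq -> |]; last first.
  by rewrite (negbTE c0Q0).
by rewrite mul0r add0r polyC0.
Qed.

Section Dimension.
Variables (k : fieldType) (p : nat) (m e : nat).
Hypotheses (pchark : p \in [pchar k]) (e_gt0 : (0 < e)%N) (m_gt0 : (0 < m)%N).
Local Notation P := {mpoly k[m.+3]}.
Local Notation gens := (@gens k p m e).
Local Notation C := (im_alg gens).
Local Notation cg := (im_gen gens).
Local Notation cval := (@im_val k m.+3 m.+3 gens).

Let p_gt0 : (0 < p)%N.
Proof. exact: prime_gt0 (pcharf_prime pchark). Qed.

(** A chain with m + 3 steps in the surface algebra gives m + 3 elements; with
    w they are m + 4 elements of P, hence dependent.  As w is a variable over the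
    surface algebra, the coefficients of the relation are relations between the
    chain elements. *)
Lemma chain_bound l : has_prime_chain C l -> (l <= m.+2)%N.
Proof.
case=> Q [Qprime Qlt]; rewrite leqNgt; apply/negP => lt.
have step i : exists c, (i < m.+3)%N ->
    c \in Q (inord i.+1) /\ c \notin Q (inord i).
  have [lti|gei] := ltnP i m.+3; last by exists 0 => //.
  have [|_ [c cin cout]] := Qlt (inord i) (inord i.+1); last by exists c.
  by rewrite !inordK //; lia.
have {step}/choice[c cP] := step.
pose h (j : 'I_m.+3) := c (m.+3 - j.+1)%N.
pose hP (j : 'I_m.+4) : P :=
  if unlift ord_max j is Some j' then cval (h j') else wpol k p m e.
have [R RN0] := algebraically_dependent hP.
rewrite horner_peel => R0; case/eqP: RN0; apply: peel_eq0.
have valE : map_poly (subst (hP \o lift ord_max)) (peel R)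
    = map_poly cval (map_poly (subst h) (peel R)).
  rewrite -map_poly_comp; apply: eq_map_poly => r.
  rewrite -[RHS]/((cval \o subst h) r).
  apply: mpoly_rmorph_ext => [a|j] /=.
    by rewrite !substC rmorph_alg.
  by rewrite !substX /hP /= liftK.
have qE : map_poly (subst h) (peel R) = 0.
  apply: (can_inj (to_polyK pchark)); rewrite rmorph0 -[RHS]R0 valE.
  by congr (_.[_]); rewrite /hP unlift_none.
apply/polyP => i; rewrite coef0.
apply: (@chain_independent k C m.+3 (fun i => Q (inord i)) c).
- by move=> l' _; apply: Qprime.
- by move=> l' lt'; apply: (proj1 (Qlt _ _ _)); rewrite !inordK //; lia.
- by move=> l' lt'; apply: cP.
- have := congr1 (fun q : {poly C} => q`_i) qE; rewrite coef_map coef0 /= => ->.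
  by case: (Qprime (inord 0)) => -[].
Qed.

(** The coordinates are numbered u, v, S, x_1, ..., x_m; they are set to 0
    starting from the end. *)
Definition vanishing (j : nat) : pred 'I_m.+3 := fun i => (m.+3 - j <= i)%N.

Lemma mpolyX_neq0 i : 'X_i != 0 :> P.
Proof. by rewrite -msupp_eq0 msuppX. Qed.

Lemma killX_in (A : pred 'I_m.+3) i : A i -> kill A 'X_i = 0 :> P.
Proof. by rewrite killX => ->. Qed.

Lemma killX_out (A : pred 'I_m.+3) i : ~~ A i -> kill A 'X_i = 'X_i :> P.
Proof. by rewrite killX => /negbTE ->. Qed.

Lemma kill_kill (A B : pred 'I_m.+3) (q : P) : subpred A B ->
  kill B (kill A q) = kill B q.
Proof.
move=> AB; rewrite -[LHS]/((kill B \o kill A) q).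
apply: mpoly_rmorph_ext => [a|i] /=; first by rewrite /kill !substC linearZ /= rmorph1.
rewrite !killX; case: ifP => [/AB ->|_]; first by rewrite rmorph0.
exact: killX.
Qed.

Definition vanishing_ideal (j : nat) : {pred C} :=
  fun c => kill (vanishing j) (cval c) == 0.

Lemma vanishing_idealE j c :
  (c \in vanishing_ideal j) = (kill (vanishing j) (cval c) == 0).
Proof. by []. Qed.

Lemma vanishing_ideal_prime j : prime_ideal_pred (vanishing_ideal j).
Proof.
split; first split.
- by rewrite vanishing_idealE !rmorph0.
- by rewrite vanishing_idealE !rmorph1 oner_eq0.
- move=> a b c; rewrite !vanishing_idealE => /eqP b0 /eqP c0.
  rewrite (rmorphD cval) (rmorphM cval) (rmorphD (kill _)) (rmorphM (kill _)) /=.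
  by rewrite b0 c0 mulr0 addr0.
- by move=> a b; rewrite !vanishing_idealE (rmorphM cval) (rmorphM (kill _)) mulf_eq0.
Qed.

Lemma vanishing_idealS i j : (i <= j)%N ->
  {subset vanishing_ideal i <= vanishing_ideal j}.
Proof.
move=> ij c; rewrite !vanishing_idealE => /eqP ci.
rewrite -(@kill_kill (vanishing i)) ?ci ?rmorph0 // => l.
by rewrite /vanishing; lia.
Qed.

(** The new element is the x_j set to 0; then t, which becomes S^(p^2) modulo x;
    then y, which becomes -v modulo x. *)
Lemma vanishing_ideal_step i : (i < m.+2)%N ->
  exists2 c, c \in vanishing_ideal i.+1 & c \notin vanishing_ideal i.
Proof.
move=> lt; have [im|] := ltnP i m.
  have lt_l : (m - i.+1 < m)%N by lia.
  exists (cg (ix (Ordinal lt_l))); rewrite vanishing_idealE cval_genx killX /vanishing /=.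
    by case: ifP => //; lia.
  by case: ifP => [|_]; [lia | apply: mpolyX_neq0].
have last_x j : (m <= j)%N -> vanishing j (ix (Ordinal m_gt0)).
  by rewrite /vanishing /=; lia.
rewrite leq_eqVlt => /orP[/eqP <-|mi].
  have tcoord0 (V S : P) : tcoord p 0 V S = S ^+ p ^+ p.
    by rewrite /tcoord mul0r add0r.
  exists (cg i1); rewrite vanishing_idealE cval_gen1 tpol.unlock rmorph_tcoord /=.
    rewrite (kill_xpow pchark e_gt0 (last_x _ (leqnSn m))) tcoord0.
    have -> : kill (vanishing m.+1) 'X_i2 = 0 :> P.
      by apply: killX_in; rewrite /vanishing /=; lia.
    by rewrite !expr0n eqn0Ngt p_gt0 expr0n eqn0Ngt p_gt0.
  rewrite (kill_xpow pchark e_gt0 (last_x _ (leqnn m))) tcoord0.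
  have -> : kill (vanishing m) 'X_i2 = 'X_i2 :> P.
    by apply: killX_out; rewrite /vanishing /=; lia.
  by rewrite !expf_neq0 // mpolyX_neq0.
have -> : i = m.+1 by lia.
exists (cg i0); rewrite vanishing_idealE cval_gen0.
  rewrite (kill_ypol pchark e_gt0 (last_x _ (leqW (leqnSn m)))).
  by rewrite killX_in ?oppr0 // /vanishing /=; lia.
rewrite (kill_ypol pchark e_gt0 (last_x _ (leqnSn m))) oppr_eq0.
by rewrite killX_out ?mpolyX_neq0 // /vanishing /=; lia.
Qed.

Lemma krull_dimension : krull_dim_is C m.+2.
Proof.
split; last exact: chain_bound.
exists (fun i => vanishing_ideal i); split; first by move=> i; apply: vanishing_ideal_prime.
move=> i j lt; split; first exact/vanishing_idealS/ltnW.
have [|c cin cout] := @vanishing_ideal_step i; first by have := ltn_ord j; lia.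
exists c; [exact: vanishing_idealS cin | exact: cout].
Qed.

End Dimension.

Unset Implicit Arguments.

(** * The family of counterexamples *)

Theorem corollary4p4 (k : fieldType) (p : nat) (hp : p \in [pchar k])
    (n : nat) (hn : (3 <= n)%N) :
  exists C : nat -> comAlgType k,
    (forall i j : nat, i <> j -> ~ ring_isomorphic (C i) (C j)) /\
    (forall i : nat,
       krull_dim_is (C i) n /\
       is_stably_polynomial_ring n.+1 (C i) /\
       ~ is_polynomial_ring n (C i)).
Proof.
case: n hn => [|[|[|m]]] // _.
exists (fun i => im_alg (@gens k p m.+1 i.+1)); split.
  move=> i j ne.
  have [lt|gt|//] := ltngtP i j; first exact: (non_isomorphic hp _ _ ord0).
  by move/ring_isomorphic_sym; apply: (non_isomorphic hp _ _ ord0).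
move=> i; split; first exact: krull_dimension.
split; first exact: stably_polynomial.
exact: (not_polynomial hp _ ord0).
Qed.
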